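(* Let $S$ be a Hausdorff semitopological semigroup and let $\Gamma$ be a quotient of $S^{\mathcal{LMC}}$ such that for all $\mathcal{A},\mathcal{B}\in\Gamma$ there is some $\mathcal{C}\in\Gamma$ with $\mathcal{C}\subseteq\mathcal{A}\odot\mathcal{B}$. Define $\dotplus$ on $\Gamma$ by letting $\mathcal{A}\dotplus\mathcal{B}$ be the element of $\Gamma$ with $\mathcal{A}\dotplus\mathcal{B}\subseteq\mathcal{A}\odot\mathcal{B}$. Then: (1) $e$ is a continuous homomorphism from $S$ to $\Gamma$; (2) $\Gamma$ (with operation $\dotplus$ and the quotient topology) is a right topological semigroup, i.e. $\dotplus$ is associative and each map $\mathcal{A}\mapsto\mathcal{A}\dotplus\mathcal{B}$ is continuous; (3) $e[S]$ is dense in $\Gamma$; and (4) for every $s\in S$, the function $\lambda_{e(s)}:\Gamma\to\Gamma$, $\lambda_{e(s)}(\mathcal{A})=e(s)\dotplus\mathcal{A}$, is continuous.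
   Context: **The compactification.** $S$ is a semigroup with a Hausdorff topology in which all maps $\lambda_s(x)=sx$ and $r_s(x)=xs$ are continuous. $\mathcal{CB}(S)$ is the $C^*$-algebra of bounded continuous complex-valued functions on $S$, and $L_sf=f\circ\lambda_s$. For a multiplicative mean (character) $\mu$, put $(\mathbf{T}_\mu f)(s)=\mu(L_sf)$. $\mathcal{LMC}(S)$ is the set of $f\in\mathcal{CB}(S)$ with $\mathbf{T}_\mu f\in\mathcal{CB}(S)$ for every character $\mu$ of $\mathcal{CB}(S)$. It is a $C^*$-subalgebra containing the constants, and it is mapped into itself by $L_s$ and by $\mathbf{T}_\mu$ for every character $\mu$ of $\mathcal{LMC}(S)$. $S^{\mathcal{LMC}}$ is the (compact Hausdorff) space of characters of $\mathcal{LMC}(S)$ with the Gelfand topology and product $\mu\nu=\mu\circ\mathbf{T}_\nu$. $\varepsilon:S\to S^{\mathcal{LMC}}$ is the evaluation map, a continuous homomorphism with dense image; $S^{\mathcal{LMC}}$ is a right topological semigroup and left multiplication by each $\varepsilon(s)$ is continuous. **Zero sets and $z$-filters.** $Z(\mathcal{LMC}(S))=\{f^{-1}(0):f\in\mathcal{LMC}(S)\}$. A $z$-filter on $\mathcal{LMC}(S)$ is a family $\mathcal{A}\subseteq Z(\mathcal{LMC}(S))$ with $S\in\mathcal{A}$, $\emptyset\notin\mathcal{A}$, closed under finite intersections and under supersets in $Z(\mathcal{LMC}(S))$. A $z$-ultrafilter is a maximal $z$-filter. For $A\subseteq S$, $\overline{A}$ denotes the closure of $\varepsilon(A)$ in $S^{\mathcal{LMC}}$,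 and for a subset $X$ of $S^{\mathcal{LMC}}$, $X^\circ$ is its interior. **Points as $z$-filters.** For every $z$-ultrafilter $p$, $\bigcap_{A\in p}\overline{A}$ is a single point $\mu_p$, and every point of $S^{\mathcal{LMC}}$ is of this form. Let $\widetilde{p}$ be the intersection of all $z$-ultrafilters $q$ with $\mu_q=\mu_p$. The map $\mu_p\mapsto\widetilde{p}$ is a bijection, by which $S^{\mathcal{LMC}}$ is identified (with its topology and product) with the set of all $z$-filters $\widetilde{p}$. For $s\in S$, $\widehat{s}=\{A\in Z(\mathcal{LMC}(S)):s\in A\}$ is a $z$-ultrafilter; it is the element of $S^{\mathcal{LMC}}$ corresponding to $\varepsilon(s)$. **Pure $z$-filters.** For a $z$-filter $\mathcal{A}$, $\overline{\mathcal{A}}=\{\widetilde{p}: p \text{ a } z\text{-ultrafilter},\ \mathcal{A}\subseteq p\}$, which equals $\bigcap_{A\in\mathcal{A}}\overline{A}$; and $\mathcal{A}^\circ=\{A\in\mathcal{A}:\overline{\mathcal{A}}\subseteq(\overline{A})^\circ\}$. A $z$-filter $\mathcal{A}$ is pure if, for every $z$-ultrafilter $p$, $\mathcal{A}\subseteq p$ implies $\mathcal{A}\subseteq\widetilde{p}$. **The operation $\odot$.** For $z$-filters $\mathcal{A},\mathcal{B}$ and $A\in Z(\mathcal{LMC}(S))$, let $\Omega_{\mathcal{B}}(A)=\{x\in S:\lambda_x^{-1}(A)\in\mathcal{B}\}$, and let $A\in\mathcal{A}+\mathcal{B}$ if and only if every $F\in Z(\mathcal{LMC}(S))$ with $\Omega_{\mathcal{B}}(A)\subseteq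 F$ belongs to $\mathcal{A}$. Put $\overline{\mathcal{A}+\mathcal{B}}=\bigcap_{A\in\mathcal{A}+\mathcal{B}}\overline{A}\subseteq S^{\mathcal{LMC}}$ and $\mathcal{A}\odot\mathcal{B}=\bigcap\overline{\mathcal{A}+\mathcal{B}}$, the intersection of all the $z$-filters $\widetilde{p}$ in $\overline{\mathcal{A}+\mathcal{B}}$. **Quotients.** A topological choice function for a set $\Gamma$ of pure $z$-filters is a function $f:\Gamma\to\bigcup\Gamma$ with $\overline{\mathcal{L}}\subseteq(\overline{f(\mathcal{L})})^\circ$ for each $\mathcal{L}\in\Gamma$. For $A\in Z(\mathcal{LMC}(S))$ let $A^*=\{\mathcal{L}\in\Gamma:\overline{\mathcal{L}}\cap\overline{A}\neq\emptyset\}$; the quotient topology on $\Gamma$ is generated by the sets $\Gamma\setminus A^*$. $\Gamma$ is a quotient of $S^{\mathcal{LMC}}$ if it is a set of pure $z$-filters on $\mathcal{LMC}(S)$ with the quotient topology such that: (i) for every topological choice function $f$ for $\Gamma$ there is a finite $\mathcal{F}\subseteq\Gamma$ with $S^{\mathcal{LMC}}=\bigcup_{\mathcal{L}\in\mathcal{F}}(\overline{f(\mathcal{L})})^\circ$; (ii) for distinct $\mathcal{L},\mathcal{K}\in\Gamma$ there exist $A\in\mathcal{L}^\circ$, $B\in\mathcal{K}^\circ$ such that for every $\mathcal{C}\in\Gamma$ and all $H,T\in Z(\mathcal{LMC}(S))$, either ($S^{\mathcal{LMC}}\setminus(\overline{A})^\circ\subseteq(\overline{H})^\circ$ implies $H\in\mathcal{C}$)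 or ($S^{\mathcal{LMC}}\setminus(\overline{B})^\circ\subseteq(\overline{T})^\circ$ implies $T\in\mathcal{C}$). In that case each $\widetilde{p}\in S^{\mathcal{LMC}}$ contains exactly one $\mathcal{L}\in\Gamma$; $\gamma:S^{\mathcal{LMC}}\to\Gamma$ is defined by $\gamma(\widetilde{p})\in\Gamma$, $\gamma(\widetilde{p})\subseteq\widetilde{p}$, and $e:S\to\Gamma$ by $e(s)=\gamma(\widehat{s})$. *)

(* Defs.v *)
From HB Require Import structures.
From mathcomp Require Import all_boot all_order all_algebra.
From mathcomp Require Import all_classical all_reals.
From mathcomp Require Import topology normedtype.
From mathcomp Require Import complex.

Set Implicit Arguments.
Unset Strict Implicit.
Unset Printing Implicit Defensive.

Import Order.TTheory GRing.Theory Num.Theory.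
Import numFieldTopology.Exports numFieldNormedType.Exports.

Local Open Scope classical_set_scope.
Local Open Scope ring_scope.

(* Typed as a numClosedFieldType so that it inherits the norm topology that
   MathComp-Analysis puts on every numeric field. *)
Definition Cplx (R : realType) : numClosedFieldType := R[i].

HB.mixin Record isSemitopological S of Semigroup S & Topological S := {
  mull_continuous : forall s : S, continuous (fun x : S => (s * x)%g);
  mulr_continuous : forall s : S, continuous (fun x : S => (x * s)%g)
}.

#[short(type="semitopologicalSemigroupType")]
HB.structure Definition SemitopologicalSemigroup :=
  {S of Semigroup S & Topological S & isSemitopological S}.

Section Means.
Context {R : realType} {S : Type}.

(* Linear functionals m on A with m multiplicative and ||m|| = m 1 = 1 for the
   supremum norm.  A is a bare set of functions, so sums and products of
   elements of A are named by the elements h of A that are equal to them. *)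
Definition multiplicative_mean (A : set (S -> Cplx R)) (m : A -> Cplx R) :=
  [/\ forall (a : Cplx R) (f g h : A),
        (forall s, \val h s = a * \val f s + \val g s) -> m h = a * m f + m g,
      forall f g h : A,
        (forall s, \val h s = \val f s * \val g s) -> m h = m f * m g,
      forall u : A, (forall s, \val u s = 1) -> m u = 1 &
      forall (f : A) (M : Cplx R),
        (forall s, `|\val f s| <= M) -> `|m f| <= M].

End Means.

Section LMC.
Context (R : realType) (S : semitopologicalSemigroupType).

Definition CB : set (S -> Cplx R) := [set f | continuous f /\ bounded_fun f].

Definition ltrans (s : S) (f : S -> Cplx R) : S -> Cplx R :=
  fun x => f (s * x)%g.

Lemma CB_ltrans (s : S) (f : CB) : ltrans s (\val f) \in CB.
Proof.
case: f => f /= /set_mem[cf [M [Mr Mf]]]; apply/mem_set; split.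
  by move=> x; apply: continuous_comp; [exact: mull_continuous|exact: cf].
by exists M; split => // N MN x _; apply: Mf.
Qed.

Definition Tmean (m : CB -> Cplx R) (f : CB) : S -> Cplx R :=
  fun s => m (exist _ (ltrans s (\val f)) (CB_ltrans s f)).

Definition LMC : set (S -> Cplx R) :=
  [set \val f | f in [set f : CB |
     forall m : CB -> Cplx R, multiplicative_mean m -> CB (Tmean m f)]].

(* The spectrum of LMC with the Gelfand topology, i.e. the subspace topology
   of the topology of pointwise convergence. *)
Definition SLMC_set : set {ptws LMC -> Cplx R} :=
  [set m | multiplicative_mean (m : LMC -> Cplx R)].

Definition SLMC : topologicalType := SLMC_set.

Lemma eval_mean (s : S) :
  ((fun f : LMC => \val f s) : {ptws LMC -> Cplx R}) \in SLMC_set.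
Proof. by apply/mem_set; split => *; auto. Qed.

Definition eps (s : S) : SLMC :=
  exist (fun m => m \in SLMC_set) _ (eval_mean s).

Definition cl (A : set S) : set SLMC := closure (eps @` A).

Definition zero_sets : set (set S) :=
  [set A | exists2 f, LMC f & A = f @^-1` [set 0]].

Definition zfilter (p : set (set S)) :=
  [/\ p `<=` zero_sets, p setT, ~ p set0,
      forall A B, p A -> p B -> p (A `&` B) &
      forall A B, zero_sets B -> A `<=` B -> p A -> p B].

Definition zultrafilter (p : set (set S)) :=
  zfilter p /\ forall q, zfilter q -> p `<=` q -> q = p.

(* For a z-ultrafilter p this is the singleton {mu_p}; "mu_p = x" is written
   [zlim p = [set x]] and "mu_q = mu_p" is written [zlim q = zlim p]. *)
Definition zlim (p : set (set S)) : set SLMC := \bigcap_(A in p) cl A.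

Definition ztilde (p : set (set S)) : set (set S) :=
  \bigcap_(q in [set q | zultrafilter q /\ zlim q = zlim p]) q.

(* The z-filter identified with the point x: it is [ztilde p] for every
   z-ultrafilter p such that mu_p = x. *)
Definition point_zfilter (x : SLMC) : set (set S) :=
  \bigcap_(q in [set q | zultrafilter q /\ zlim q = [set x]]) q.

Definition hull (F : set (set S)) : set SLMC :=
  [set x | exists p, [/\ zultrafilter p, F `<=` p & zlim p = [set x]]].

Definition zinterior (F : set (set S)) : set (set S) :=
  [set A | F A /\ hull F `<=` (cl A)^°].

Definition pure (F : set (set S)) :=
  forall p, zultrafilter p -> F `<=` p -> F `<=` ztilde p.

Definition Omega (B : set (set S)) (A : set S) : set S :=
  [set x | B ((fun y => (x * y)%g) @^-1` A)].

Definition zadd (F G : set (set S)) : set (set S) :=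
  [set A | zero_sets A /\
     forall H, zero_sets H -> Omega G A `<=` H -> F H].

Definition odot (F G : set (set S)) : set (set S) :=
  \bigcap_(x in \bigcap_(A in zadd F G) cl A) point_zfilter x.

Section Quotient.
Context (Gamma : set (set (set S))).

Definition topological_choice (f : Gamma -> set S) :=
  forall L : Gamma,
    (\bigcup_(K in Gamma) K) (f L) /\ hull (\val L) `<=` (cl (f L))^°.

Definition star (A : set S) : set Gamma :=
  [set L | hull (\val L) `&` cl A !=set0].

Definition is_quotient :=
  [/\ forall L, Gamma L -> zfilter L /\ pure L,
      forall f : Gamma -> set S, topological_choice f ->
        exists2 F : set Gamma, finite_set F &
          \bigcup_(L in F) (cl (f L))^° = setT &
      forall L K, Gamma L -> Gamma K -> L <> K ->
        exists A B, [/\ zinterior L A, zinterior K B &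
          forall C H T, Gamma C -> zero_sets H -> zero_sets T ->
            (~` (cl A)^° `<=` (cl H)^° -> C H) \/
            (~` (cl B)^° `<=` (cl T)^° -> C T)]].

End Quotient.

End LMC.

(* Gamma as a space; R is kept as a parameter because the topology depends on
   it. *)
Definition quotient_space (R : realType) (S : semitopologicalSemigroupType)
  (Gamma : set (set (set S))) : Type := Gamma.

Section QuotientTopology.
Context (R : realType) (S : semitopologicalSemigroupType).
Context (Gamma : set (set (set S))).

HB.instance Definition _ := Choice.on (quotient_space R Gamma).
HB.instance Definition _ := isSubBaseTopological.Build
  (quotient_space R Gamma) (@zero_sets R S) (fun A => ~` star R A).

End QuotientTopology.

Definition right_topological_semigroup (X : topologicalType)
    (op : X -> X -> X) :=
  associative op /\ forall y, continuous (fun x => op x y).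

(* Main.v *)
(** Every point of X = S^LMC is the limit, on LMC(S), of an ultrafilter on S, and
    every ultrafilter on S defines a point: a multiplicative mean m on an
    inverse-closed *-algebra A of bounded functions is the limit along the filter
    generated by the sets {|h| < 1} with h in A and m h = 0.  So LMC(S) can be
    handled through iterated ultrafilter limits, which gives the compactness of X,
    the extension of means from LMC(S) to CB(S) and the product of X.

    The hull of a z-filter is the intersection of the closures of its members, and
    a pure z-filter L lies in the z-filter of x exactly when x is in hull L.
    Hence the hulls of the elements of Gamma partition X, condition (ii) makes the
    corresponding equivalence relation closed, and Gamma is the Hausdorff quotient
    of X by it, with quotient map gamma.  If x is in hull A and y in hull B,
    then xy is in the closure of every member of zadd A B; so dotplus maps
    (gamma x, gamma y) to gamma (xy), and all four claims descend from X to
    Gamma. *)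

Require Import Defs.
From mathcomp Require Import all_boot all_order all_algebra.
From mathcomp Require Import all_classical all_reals.
From mathcomp Require Import topology normedtype.
From mathcomp Require Import complex.

Set Implicit Arguments.
Unset Strict Implicit.
Unset Printing Implicit Defensive.

Import Order.TTheory GRing.Theory Num.Theory.
Import numFieldTopology.Exports numFieldNormedType.Exports.

Local Open Scope classical_set_scope.
Local Open Scope ring_scope.

(** * Compactness in the complex plane *)

Lemma ultra_fmap (T U : Type) (f : T -> U) (F : set_system T) :
  UltraFilter F -> UltraFilter (f @ F).
Proof.
move=> FU; split=> [|G GF sFG]; first exact: fmap_proper_filter.
rewrite predeqE => A; split; last exact: sFG.
move=> GA; have [//|FnA] := in_ultra_setVsetC (f @^-1` A) FU.
have /(filterI GA) : G (~` A) by exact: sFG.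
by rewrite setICr => /filter_not_empty.
Qed.

Section ComplexPlane.
Context {R : realType}.
Local Notation C := (Cplx R).

(** The squared norm is below [a ^+ 2 + b ^+ 2], which is at most [(a + b) ^+ 2]. *)
Lemma complex_lt_norm (z : C) (a b : R) :
  `|complex.Re z| < a -> `|complex.Im z| < b -> `|z| < ((a + b)%:C)%C :> C.
Proof.
move=> za zb; have a0 := le_lt_trans (normr_ge0 _) za.
have b0 := le_lt_trans (normr_ge0 _) zb.
rewrite [`|z|]normc_def ltcR -(@ger0_norm _ (a + b)) ?addr_ge0 ?ltW //.
rewrite -sqrtr_sqr ltr_sqrt; last by rewrite exprn_gt0 ?addr_gt0.
have sq_lt (x c : R) : `|x| < c -> x ^+ 2 < c ^+ 2.
  move=> xc; rewrite -real_normK ?num_real // ltr_pXn2r ?nnegrE //.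
  exact/ltW/(le_lt_trans _ xc).
apply: (lt_le_trans (ltrD (sq_lt _ _ za) (sq_lt _ _ zb))).
by rewrite sqrrD lerD2r lerDl mulrn_wge0 // mulr_ge0 // ltW.
Qed.

Lemma complex_pair_continuous : continuous (fun p : R * R => (p.1 +i* p.2)%C : C).
Proof.
move=> p; apply/cvgrPdist_lt => e e0.
(* A positive element of [C] is real, so half of its real part is an admissible tolerance for each
   coordinate. *)
have eE : e = ((complex.Re e)%:C)%C :> C.
  by rewrite RRe_real // ger0_real // ltW.
have d0 : 0 < complex.Re e / 2.
  by rewrite divr_gt0 //; move: e0; rewrite eE ltcR.
have nearE (q : R * R -> R) : q t @[t --> p] --> q p ->
    \forall t \near p, `|q p - q t| < complex.Re e / 2.
  by move=> cq; exact: cvgr_dist_lt cq _ d0.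
near=> t; rewrite eE [complex.Re e]splitr.
by apply: complex_lt_norm => /=; near: t; apply: nearE;
  [exact: cvg_fst|exact: cvg_snd].
Unshelve. all: by end_near. Qed.

(** A bound on the norm bounds both coordinates by [Re M]; the compact set is the image of the
    square with these bounds. *)
Lemma disc_sub_compact (M : C) :
  exists2 K : set C, compact K & [set z : C | `|z| <= M] `<=` K.
Proof.
pose I := [set` `[- complex.Re M, complex.Re M]%R] : set R.
exists ((fun p : R * R => (p.1 +i* p.2)%C : C) @` (I `*` I)).
  apply: continuous_compact; last by apply: compact_setX; exact: segment_compact.
  by apply: continuous_subspaceT; exact: complex_pair_continuous.
move=> [a b] /=; rewrite [`|_|]normc_def lecE /= => /andP[_ abM].
exists (a, b) => //; split; rewrite /I /= in_itv /= -ler_norml (le_trans _ abM) //.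
  by rewrite -sqrtr_sqr ler_wsqrtr // lerDl sqr_ge0.
by rewrite -sqrtr_sqr ler_wsqrtr // lerDr sqr_ge0.
Qed.

Lemma ultra_bounded_cvg (T : Type) (F : set_system T) (f : T -> C) (M : C) :
  UltraFilter F -> (forall t, `|f t| <= M) -> exists l : C, f @ F --> l.
Proof.
move=> FU fM; have [K cK sK] := disc_sub_compact M.
have FfU := ultra_fmap f FU.
move: cK; rewrite compact_ultra => /(_ _ FfU) [|l [_ fl]]; last by exists l.
suff : F (f @^-1` K) by [].
by apply: (@filterE T F _) => t; exact: (sK _ (fM t)).
Qed.

Lemma Cplx_hausdorff : hausdorff_space C.
Proof. exact: norm_hausdorff. Qed.

Lemma conj_continuous : continuous (fun z : C => z^*).
Proof.
move=> z; apply/(@cvgrPdist_lt _ _ _ _ (nbhs_filter z)) => e e0.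
have := @cvgr_dist_lt _ _ _ _ (nbhs_filter z) id z (@cvg_id _ _) e e0.
by apply: filterS => t; rewrite -rmorphB norm_conjC.
Qed.

Lemma cvg_conj (T : Type) (F : set_system T) (FF : Filter F) (f : T -> C) (l : C) :
  f @ F --> l -> (fun t => (f t)^*) @ F --> l^*.
Proof. by move=> fl; apply: (cvg_comp _ _ fl); exact: conj_continuous. Qed.

(** The order of [C] is partial, but norms are real and so comparable with 1. *)
Lemma real_ltPge1 (z : C) : ~ `|z| < 1 -> 1 <= `|z|.
Proof. by move/negP; rewrite real_leNgt ?real1 ?normr_real. Qed.

End ComplexPlane.

(** * Means as limits along filters *)

Section Means.
Context {R : realType} {T : Type}.
Local Notation C := (Cplx R).

(** The closure properties shared by [CB] and [LMC]. Inverse-closedness forces every function in the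
    kernel of a mean to take small values. *)
Record star_algebra (A : set (T -> C)) : Prop := StarAlgebra {
  star_cst : forall c, A (fun=> c);
  star_add : forall f g, A f -> A g -> A (fun s => f s + g s);
  star_mul : forall f g, A f -> A g -> A (fun s => f s * g s);
  star_conj : forall f, A f -> A (fun s => (f s)^*);
  star_bounded : forall f, A f -> exists M, forall s, `|f s| <= M;
  star_inv : forall f d, A f -> 0 < d -> (forall s, d <= `|f s|) ->
    A (fun s => (f s)^-1)
}.

(** Extension by 0 outside [A], so that a mean applies to plain functions without membership
    proofs. *)
Definition extend (A : set (T -> C)) (m : A -> C) (f : T -> C) : C :=
  if pselect (f \in A) is left Af then m (exist _ f Af) else 0.

Lemma extendE (A : set (T -> C)) (m : A -> C) (f : A) : extend m (\val f) = m f.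
Proof.
rewrite /extend; case: pselect => [Af|]; last by case: f => f /= Af /(_ Af).
by congr m; exact: val_inj.
Qed.

Lemma extend_exist (A : set (T -> C)) (m : A -> C) f (Af : f \in A) :
  extend m f = m (exist _ f Af).
Proof. by rewrite -extendE. Qed.

Section MeanRules.
Context (A : set (T -> C)) (m : A -> C).
Context (algA : star_algebra A) (meanm : multiplicative_mean m).

Lemma mean_lin a f g : A f -> A g ->
  extend m (fun s => a * f s + g s) = a * extend m f + extend m g.
Proof.
move=> Af Ag; have Ah : A (fun s => a * f s + g s).
  by apply: (star_add algA) Ag; apply: (star_mul algA) Af; exact: star_cst.
rewrite (extend_exist _ (mem_set Af)) (extend_exist _ (mem_set Ag)).
by rewrite (extend_exist _ (mem_set Ah)); case: meanm => + _ _ _; apply.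
Qed.

Lemma mean_mul f g : A f -> A g ->
  extend m (fun s => f s * g s) = extend m f * extend m g.
Proof.
move=> Af Ag; have Ah := star_mul algA Af Ag.
rewrite (extend_exist _ (mem_set Af)) (extend_exist _ (mem_set Ag)).
by rewrite (extend_exist _ (mem_set Ah)); case: meanm => _ + _ _; apply.
Qed.

Lemma mean_one : extend m (fun=> 1) = 1.
Proof.
rewrite (extend_exist _ (mem_set (star_cst algA 1))).
by case: meanm => _ _ + _; apply.
Qed.

Lemma mean_zero : extend m (fun=> 0) = 0.
Proof.
transitivity (-1 * extend m (fun=> 0) + extend m (fun=> 0)).
  rewrite -(mean_lin _ (star_cst algA 0) (star_cst algA 0)).
  by congr extend; apply/funext => s; rewrite mulr0 addr0.
by rewrite mulN1r addNr.
Qed.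

Lemma mean_cst c : extend m (fun=> c) = c.
Proof.
transitivity (c * extend m (fun=> 1) + extend m (fun=> 0)).
  rewrite -(mean_lin _ (star_cst algA 1) (star_cst algA 0)).
  by congr extend; apply/funext => s; rewrite mulr1 addr0.
by rewrite mean_one mean_zero mulr1 addr0.
Qed.

Lemma mean_add f g : A f -> A g ->
  extend m (fun s => f s + g s) = extend m f + extend m g.
Proof.
move=> Af Ag; have := mean_lin 1 Af Ag; rewrite mul1r => <-.
by congr extend; apply/funext => s; rewrite mul1r.
Qed.

(* Otherwise h would be invertible in A. *)
Lemma mean_ker_small h : A h -> extend m h = 0 -> exists s, `|h s| < 1.
Proof.
move=> Ah mh; apply: contrapT => /forallNP hge.
have h1 s : 1 <= `|h s| by apply: real_ltPge1; exact: hge.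
have Ahi := star_inv algA Ah ltr01 h1.
have := mean_mul Ah Ahi; rewrite mh mul0r.
rewrite (_ : (fun s => _) = fun=> 1) ?mean_one; last first.
  by apply/funext => s; rewrite divff // -normr_gt0 (lt_le_trans ltr01).
by move/eqP; rewrite oner_eq0.
Qed.

End MeanRules.

(** The bound 1 stands for every positive bound when [B] is closed under scalar multiples, as are
    the sets used below. *)
Definition sublevel_filter (U : Type) (B : set (U -> C)) : set_system U :=
  filter_from B (fun h => [set t | `|h t| < 1]).

(** Where [|g|^2 + |h|^2] is below 1, so are [|g|] and [|h|]; this function therefore refines both
    basic sets. *)
Lemma sublevel_filterP (U : Type) (B : set (U -> C)) : B (fun=> 0) ->
  (forall g h, B g -> B h ->
    B (fun t => g t * (g t)^* + h t * (h t)^*)) ->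
  Filter (sublevel_filter B).
Proof.
move=> B0 BD; apply: filter_from_filter; first by exists (fun=> 0).
have lt1 (x y : C) : 0 <= y -> `| `|x| ^+ 2 + y | < 1 -> `|x| < 1.
  move=> y0; rewrite ger0_norm ?addr_ge0 ?exprn_ge0 // => xy1.
  rewrite -(@expr_lt1 _ 2) //; apply: le_lt_trans xy1.
  by rewrite lerDl.
move=> g h Bg Bh; exists (fun t => g t * (g t)^* + h t * (h t)^*).
  exact: BD.
move=> t /=; rewrite -!normCK => gh1; split => /=.
  by apply: lt1 gh1; rewrite exprn_ge0.
by rewrite addrC in gh1; apply: lt1 gh1; rewrite exprn_ge0.
Qed.

Lemma mean_filter (A : set (T -> C)) (m : A -> C) :
  star_algebra A -> multiplicative_mean m ->
  exists2 F : set_system T, ProperFilter F &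
    forall f, A f -> f @ F --> extend m f.
Proof.
move=> algA meanm; pose B := [set h | A h /\ extend m h = 0].
have FF : Filter (sublevel_filter B).
  apply: sublevel_filterP => [|g h [Ag mg] [Ah mh]].
    by split; [exact: star_cst|exact: mean_zero].
  have Agg := star_mul algA Ag (star_conj algA Ag).
  have Ahh := star_mul algA Ah (star_conj algA Ah).
  split; first exact: star_add.
  rewrite (mean_add algA meanm Agg Ahh).
  rewrite (mean_mul algA meanm Ag (star_conj algA Ag)).
  by rewrite (mean_mul algA meanm Ah (star_conj algA Ah)) mg mh !mul0r addr0.
exists (sublevel_filter B) => [|f Af].
  by apply: filter_from_proper => // h [Ah]; exact: mean_ker_small.
apply/(@cvgrPdist_lt _ _ _ _ FF) => e e0.
(* This is [(m f - f) / e], an element of the kernel of [m] whose modulus is below 1 exactly where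
   [f] is within [e] of [m f]. *)
exists (fun s => - e^-1 * f s + e^-1 * extend m f).
  split; last first.
    rewrite (mean_lin algA meanm _ Af (star_cst algA _)) (mean_cst algA meanm).
    by rewrite mulNr addNr.
  apply: (star_add algA); last exact: (star_cst algA).
  by apply: (star_mul algA) Af; exact: (star_cst algA).
move=> s /=; rewrite mulNr addrC -mulrBr normrM (gtr0_norm (_ : 0 < e^-1)) ?invr_gt0 //.
by rewrite mulrC ltr_pdivrMr // mul1r.
Qed.

Lemma cvg_mean (A : set (T -> C)) (m : A -> C) (F : set_system T) :
  ProperFilter F -> (forall f : A, \val f @ F --> m f) -> multiplicative_mean m.
Proof.
move=> FF mF; have uniq (g : T -> C) (a b : C) : g @ F --> a -> g @ F --> b -> a = b.
  by move=> ga gb; exact: (cvg_unique (@Cplx_hausdorff R) ga gb).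
split.
- move=> a f g h hE; apply: (uniq _ _ _ (mF h)).
  rewrite (_ : \val h = (fun s => a * \val f s + \val g s)); last exact/funext.
  by apply: cvgD (mF g); apply: cvgM (mF f); exact: cvg_cst.
- move=> f g h hE; apply: (uniq _ _ _ (mF h)).
  rewrite (_ : \val h = (fun s => \val f s * \val g s)); last exact/funext.
  exact: cvgM.
- move=> u u1; apply: (uniq _ _ _ (mF u)).
  rewrite (_ : \val u = fun=> 1); last exact/funext.
  exact: cvg_cst.
(* A point [s] exists because the filter is proper, and [|f s| <= M] makes [M] real, hence
   comparable with norms. *)
- move=> f M fM; have [s _] := filter_ex (@filterT _ F _).
  have Mr : M \is Num.real by exact/ger0_real/(le_trans (normr_ge0 _) (fM s)).
  rewrite real_leNgt ?normr_real //; apply/negP => Mf.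
  have Mt : \forall t \near F, M < `|\val f t|.
    exact: (@cvgr_norm_gt _ _ _ F _ _ _ (mF f) _ Mf).
  have [t] := filter_ex Mt.
  by rewrite real_ltNge ?normr_real // fM.
Qed.

End Means.

(** * Limits along ultrafilters *)

Section UltrafilterLimits.
Context {R : realType}.
Local Notation C := (Cplx R).

Lemma ultrafilter_of_dichotomy (T : Type) (F : set_system T) :
  ProperFilter F -> (forall A, F A \/ F (~` A)) -> UltraFilter F.
Proof.
move=> FF FC; split=> // G GF sFG; rewrite predeqE => A; split; last exact: sFG.
move=> GA; have [//|/sFG/(filterI GA)] := FC A.
by rewrite setICr => /filter_not_empty.
Qed.

(** The bind of the filter monad: limits along it are iterated limits, first along [F t], then in
    [t] along [G]. *)
Definition filter_bind (U V : Type) (G : set_system U) (F : U -> set_system V) :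
  set_system V := [set A | G [set t | F t A]].

Lemma filter_bind_ultra (U V : Type) (G : set_system U) (F : U -> set_system V) :
  UltraFilter G -> (forall t, UltraFilter (F t)) -> UltraFilter (filter_bind G F).
Proof.
move=> GU FU; apply: ultrafilter_of_dichotomy => [|A].
  apply: Build_ProperFilter_ex.
    move=> A GA; have [t FA] := @filter_ex _ G _ _ GA.
    exact: (@filter_ex _ (F t) _ _ FA).
  split.
  - by apply: (@filterE _ G) => t; exact: filterT.
  - move=> A B GA GB; apply: (@filterS2 _ G _ _ _ _ _ GA GB) => t.
    exact: filterI.
  - by move=> A B sAB; apply: (@filterS _ G) => t; exact: filterS.
have [GA|GA] := in_ultra_setVsetC [set t | F t A] GU; first by left.
right; apply: (@filterS _ G) GA => t.
by have [|//] := in_ultra_setVsetC A (FU t).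
Qed.

Lemma filter_bind_cvg (U V : Type) (G : set_system U) (F : U -> set_system V)
    (f : V -> C) (g : U -> C) (l : C) :
    UltraFilter G -> (forall t, UltraFilter (F t)) ->
  (forall t, f @ F t --> g t) -> g @ G --> l -> f @ filter_bind G F --> l.
Proof.
move=> GU FU fg gl; have BU := filter_bind_ultra GU FU.
have BF : Filter (filter_bind G F) by exact: _.
apply/(@cvgrPdist_lt _ _ _ _ BF) => e e0.
have e20 : 0 < e / 2 by rewrite divr_gt0.
have Gg : \forall t \near G, `|l - g t| < e / 2.
  exact: (@cvgr_dist_lt _ _ _ G _ _ _ gl _ e20).
suff : G [set t | F t [set s | `|l - f s| < e]] by [].
apply: (@filterS _ G _ _ _ _ Gg) => t lgt.
have Ff : \forall s \near F t, `|g t - f s| < e / 2.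
  exact: (@cvgr_dist_lt _ _ _ (F t) _ _ _ (fg t) _ e20).
apply: (@filterS _ (F t) _ _ _ _ Ff) => s gfs /=.
rewrite (le_lt_trans (ler_distD (g t) _ _)) // [ltRHS]splitr ltrD //.
Qed.

(** The default 0 is never reached for a bounded function along an ultrafilter, which always has a
    limit. *)
Definition flim (T : Type) (F : set_system T) (f : T -> C) : C :=
  xget 0 [set l : C | f @ F --> l].

Lemma flimE (T : Type) (F : set_system T) (f : T -> C) (l : C) :
  ProperFilter F -> f @ F --> l -> flim F f = l.
Proof.
move=> FF fl; rewrite /flim; case: xgetP => [a _ fa|/(_ l)//].
exact: (cvg_unique (@Cplx_hausdorff R) fa fl).
Qed.

Definition bounded_fct (T : Type) (f : T -> C) :=
  exists M : C, forall t, `|f t| <= M.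

Lemma flim_cvg (T : Type) (F : set_system T) (f : T -> C) :
  UltraFilter F -> bounded_fct f -> f @ F --> flim F f.
Proof.
move=> FU [M fM]; have [l fl] := ultra_bounded_cvg FU fM.
by rewrite (flimE _ fl).
Qed.

Section Rules.
Context (T : Type) (F : set_system T) (FU : UltraFilter F).
Implicit Types f g : T -> C.

Lemma flim_cst (c : C) : flim F (fun=> c) = c.
Proof. by apply: flimE; exact: cvg_cst. Qed.

Lemma flim_add f g : bounded_fct f -> bounded_fct g ->
  flim F (fun t => f t + g t) = flim F f + flim F g.
Proof. by move=> bf bg; apply: flimE; apply: cvgD; exact: flim_cvg. Qed.

Lemma flim_mul f g : bounded_fct f -> bounded_fct g ->
  flim F (fun t => f t * g t) = flim F f * flim F g.
Proof. by move=> bf bg; apply: flimE; apply: cvgM; exact: flim_cvg. Qed.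

Lemma flim_conj f : bounded_fct f -> flim F (fun t => (f t)^*) = (flim F f)^*.
Proof. by move=> bf; apply: flimE; apply: cvg_conj; exact: flim_cvg. Qed.

Lemma flim_norm f : bounded_fct f -> flim F (fun t => `|f t|) = `|flim F f|.
Proof. by move=> bf; apply: flimE; apply: cvg_norm; exact: flim_cvg. Qed.

Lemma flim_norm_ge f (d : C) : bounded_fct f -> (forall t, d <= `|f t|) ->
  d \is Num.real -> d <= `|flim F f|.
Proof.
move=> bf df dr; rewrite real_leNgt ?normr_real //; apply/negP => fd.
have Mt : \forall t \near F, `|f t| < d.
  exact: (@cvgr_norm_lt _ _ _ F _ _ _ (flim_cvg FU bf) _ fd).
by have [t] := filter_ex Mt; rewrite real_ltNge ?normr_real // df.
Qed.

Lemma flim_norm_le f (d : C) : (forall t, `|f t| <= d) -> `|flim F f| <= d.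
Proof.
move=> fd; have bf : bounded_fct f by exists d.
have [s _] := filter_ex (@filterT _ F _).
have dr : d \is Num.real by exact/ger0_real/(le_trans (normr_ge0 _) (fd s)).
rewrite real_leNgt ?normr_real //; apply/negP => df.
have Mt : \forall t \near F, d < `|f t|.
  exact: (@cvgr_norm_gt _ _ _ F _ _ _ (flim_cvg FU bf) _ df).
by have [t] := filter_ex Mt; rewrite real_ltNge ?normr_real // fd.
Qed.

(** The lower bound [d] passes to the limit, which is therefore nonzero, and inversion is continuous
    there. *)
Lemma flim_inv f (d : C) : bounded_fct f -> 0 < d -> (forall t, d <= `|f t|) ->
  flim F (fun t => (f t)^-1) = (flim F f)^-1.
Proof.
move=> bf d0 df; apply: flimE; apply: cvgV; last exact: flim_cvg.
by rewrite -normr_gt0 (lt_le_trans d0) // flim_norm_ge // gtr0_real.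
Qed.

End Rules.

Lemma flim_mean (T : Type) (F : set_system T) (A : set (T -> C)) :
  UltraFilter F -> (forall f, A f -> bounded_fct f) ->
  multiplicative_mean (fun f : A => flim F (\val f)).
Proof.
move=> FU bA; apply: (@cvg_mean _ _ _ _ F) => f.
by apply: flim_cvg; apply: bA; exact: set_valP.
Qed.

(** Refining the filter of [mean_filter] to an ultrafilter keeps its limits. *)
Lemma mean_ultrafilter (T : Type) (A : set (T -> C)) (m : A -> C) :
  star_algebra A -> multiplicative_mean m ->
  exists2 F : set_system T, UltraFilter F & forall f : A, m f = flim F (\val f).
Proof.
move=> algA meanm; have [F FF Fm] := mean_filter algA meanm.
have [G [GU sFG]] := ultraFilterLemma FF; exists G => // f.
rewrite -extendE; apply/esym/flimE.
by move=> B /(Fm _ (set_valP f)); exact: sFG.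
Qed.

End UltrafilterLimits.

(** * The algebra LMC(S) *)

Section LMCAlgebra.
Context {R : realType} {S : semitopologicalSemigroupType}.
Local Notation C := (Cplx R).
Local Notation CB := (@CB R S).
Local Notation LMC := (@LMC R S).

Lemma bounded_funP (T : Type) (f : T -> C) : bounded_fun f <-> bounded_fct f.
Proof.
split=> [[M [Mr Mf]]|[M fM]].
  exists (M + 1) => t; apply: Mf => //.
  by rewrite ltrDl.
exists `|M|; split => [|N MN t _]; first exact: normr_real.
apply: (le_trans (fM t)); apply: le_trans (ltW MN).
by rewrite real_ler_norm // ger0_real // (le_trans _ (fM t)).
Qed.

Lemma CB_bounded f : CB f -> bounded_fct f.
Proof. by case=> _ /bounded_funP. Qed.

Lemma CB_star_algebra : star_algebra CB.
Proof.
split.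
- move=> c; split; first exact: cst_continuous.
  by apply/bounded_funP; exists `|c|.
- move=> f g [cf /bounded_funP[M fM]] [cg /bounded_funP[N gN]]; split.
    by move=> s; apply: cvgD; [exact: cf|exact: cg].
  apply/bounded_funP; exists (M + N) => s.
  by rewrite (le_trans (ler_normD _ _)) // lerD.
- move=> f g [cf /bounded_funP[M fM]] [cg /bounded_funP[N gN]]; split.
    by move=> s; apply: cvgM; [exact: cf|exact: cg].
  apply/bounded_funP; exists (M * N) => s.
  by rewrite normrM ler_pM.
- move=> f [cf /bounded_funP[M fM]]; split.
    by move=> s; apply: cvg_conj; exact: cf.
  by apply/bounded_funP; exists M => s; rewrite norm_conjC.
- by move=> f /CB_bounded.
- move=> f d [cf _] d0 df.
  have f0 s : f s != 0 by rewrite -normr_gt0 (lt_le_trans d0).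
  split; first by move=> s; apply: cvgV => //; exact: cf.
  by apply/bounded_funP; exists d^-1 => s; rewrite normfV lef_pV2 // posrE normr_gt0.
Qed.

Lemma CB_norm f : CB f -> CB (fun s => `|f s|).
Proof.
move=> [cf /bounded_funP[M fM]]; split; first by move=> s; apply: cvg_norm; exact: cf.
by apply/bounded_funP; exists M => s; rewrite normr_id.
Qed.

(** The means on [CB] are the limits along ultrafilters, so quantification over means becomes
    quantification over ultrafilters on [S]. *)
Lemma LMCP f : LMC f <-> CB f /\ forall F : set_system S, UltraFilter F ->
  CB (fun s => flim F (ltrans s f)).
Proof.
split=> [[g Tg <-]|[CBf Tf]].
  split=> [|F FU]; first exact: set_valP.
  exact: Tg (flim_mean FU CB_bounded).
exists (exist _ f (mem_set CBf)) => // m.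
move=> /(mean_ultrafilter CB_star_algebra)[F FU mF].
have -> : Tmean m (exist _ f (mem_set CBf)) = fun s => flim F (ltrans s f).
  by apply/funext => s; rewrite /Tmean mF.
exact: Tf.
Qed.

Lemma LMC_bounded f : LMC f -> bounded_fct f.
Proof. by move=> /LMCP[/CB_bounded]. Qed.

Lemma bounded_ltrans (f : S -> C) s : bounded_fct f -> bounded_fct (ltrans s f).
Proof. by move=> [M fM]; exists M => t; exact: fM. Qed.

Lemma LMC_bounded_ltrans f s : LMC f -> bounded_fct (ltrans s f).
Proof. by move=> /LMC_bounded/bounded_ltrans. Qed.

(** Limits along an ultrafilter commute with the operations, so each closure property is inherited
    from [CB] through the functions [T_F f]. *)
Lemma LMC_star_algebra : star_algebra LMC.
Proof.
split.
- move=> c; apply/LMCP; split => [|F FU]; first exact: star_cst CB_star_algebra _.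
  rewrite [X in CB X](_ : _ = fun=> c); first exact: star_cst CB_star_algebra _.
  by apply/funext => s; exact: flim_cst.
- move=> f g Lf Lg; have /LMCP[Cf Tf] := Lf; have /LMCP[Cg Tg] := Lg.
  apply/LMCP; split => [|F FU]; first exact: star_add CB_star_algebra _ _ _ _.
  have := star_add CB_star_algebra (Tf F FU) (Tg F FU).
  congr CB; apply/funext => s.
  by rewrite -flim_add //; exact: LMC_bounded_ltrans.
- move=> f g Lf Lg; have /LMCP[Cf Tf] := Lf; have /LMCP[Cg Tg] := Lg.
  apply/LMCP; split => [|F FU]; first exact: star_mul CB_star_algebra _ _ _ _.
  have := star_mul CB_star_algebra (Tf F FU) (Tg F FU).
  congr CB; apply/funext => s.
  by rewrite -flim_mul //; exact: LMC_bounded_ltrans.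
- move=> f Lf; have /LMCP[Cf Tf] := Lf.
  apply/LMCP; split => [|F FU]; first exact: star_conj CB_star_algebra _ _.
  have := star_conj CB_star_algebra (Tf F FU).
  congr CB; apply/funext => s.
  by rewrite -flim_conj //; exact: LMC_bounded_ltrans.
- by move=> f /LMC_bounded.
- move=> f d Lf d0 df; have /LMCP[Cf Tf] := Lf.
  apply/LMCP; split => [|F FU]; first exact: (star_inv CB_star_algebra Cf d0 df).
  (* [T_F f] must itself be bounded away from 0 for its inverse to be in [CB]. *)
  have Tge s : d <= `|flim F (ltrans s f)|.
    apply: flim_norm_ge; [exact: LMC_bounded_ltrans|by move=> t; exact: df|].
    exact: gtr0_real.
  have := star_inv CB_star_algebra (Tf F FU) d0 Tge.
  congr CB; apply/funext => s.
  have bT : bounded_fct (ltrans s f) by exact: LMC_bounded_ltrans.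
  by rewrite -(flim_inv FU bT d0) // => t; exact: df.
Qed.

Lemma LMC_norm f : LMC f -> LMC (fun s => `|f s|).
Proof.
move=> Lf; have /LMCP[Cf Tf] := Lf.
apply/LMCP; split => [|F FU]; first exact: CB_norm.
have := CB_norm (Tf F FU); congr CB; apply/funext => s.
by rewrite -flim_norm //; exact: LMC_bounded_ltrans.
Qed.

Lemma ltransM s t (f : S -> C) : ltrans s (ltrans t f) = ltrans (t * s)%g f.
Proof. by apply/funext => u; rewrite /ltrans mulgA. Qed.

(** Translation commutes with [T_F]: [T_F (L_s f) = L_s (T_F f)]. *)
Lemma LMC_ltrans s f : LMC f -> LMC (ltrans s f).
Proof.
have CB_ltr g : CB g -> CB (ltrans s g).
  move=> Cg; apply/set_mem.
  exact: (CB_ltrans s (exist (fun h => h \in CB) g (mem_set Cg))).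
move=> /LMCP[Cf Tf]; apply/LMCP; split => [|F FU]; first exact: CB_ltr.
by have := CB_ltr _ (Tf F FU); congr CB; apply/funext => t; rewrite ltransM.
Qed.

(** Applying [T_G] to [T_F f] gives [T_H f], where [H] is the bind of [G] with the left translates
    of [F], so the hypothesis on [f] applies to [H]. *)
Lemma LMC_flim f (F : set_system S) : UltraFilter F -> LMC f ->
  LMC (fun s => flim F (ltrans s f)).
Proof.
move=> FU Lf; have /LMCP[Cf Tf] := Lf; apply/LMCP; split => [|G GU]; first exact: Tf.
have FtU (t : S) : UltraFilter ((fun r => t * r)%g @ F) by exact: ultra_fmap.
have := Tf _ (filter_bind_ultra GU FtU).
congr CB; apply/funext => s; have bF := filter_bind_ultra GU FtU.
pose g t := flim F (ltrans (s * t)%g f).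
apply: flimE; apply: (filter_bind_cvg GU FtU (g := g)).
  move=> t; rewrite /g; have := flim_cvg FU (LMC_bounded_ltrans (s * t)%g Lf).
  by rewrite -ltransM.
apply: flim_cvg; have [M fM] := LMC_bounded Lf.
by exists M => t; apply: flim_norm_le => r; exact: fM.
Qed.

End LMCAlgebra.

(** * The spectrum of LMC(S) *)

Section Spectrum.
Context {R : realType} {S : semitopologicalSemigroupType}.
Local Notation C := (Cplx R).
Local Notation LMC := (@LMC R S).
Local Notation X := (SLMC R S).

(** The Gelfand transform of [f], set to 0 when [f] is not in [LMC]. *)
Definition hat (f : S -> C) (x : X) : C := extend (\val x : LMC -> C) f.

Lemma hat_eps f s : LMC f -> hat f (eps R s) = f s.
Proof. by move=> Lf; rewrite /hat (extend_exist _ (mem_set Lf)). Qed.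

Lemma hat_inj x y : (forall f, LMC f -> hat f x = hat f y) -> x = y.
Proof.
move=> xy; apply: val_inj; apply/funext => f.
by have := xy (\val f) (set_valP f); rewrite /hat !extendE.
Qed.

Lemma hat_ultrafilter x : exists2 F : set_system S, UltraFilter F &
  forall f, LMC f -> hat f x = flim F f.
Proof.
have [F FU xF] := mean_ultrafilter LMC_star_algebra (set_mem (valP x)).
by exists F => // f Lf; rewrite /hat (extend_exist _ (mem_set Lf)) xF.
Qed.

(** An arbitrary choice among the ultrafilters representing [x]; they all give the same limits on
    [LMC]. *)
Definition ultra_at x : set_system S := projT1 (cid2 (hat_ultrafilter x)).

Lemma ultra_at_ultra x : UltraFilter (ultra_at x).
Proof. by rewrite /ultra_at; case: cid2. Qed.

Lemma hatE f x : LMC f -> hat f x = flim (ultra_at x) f.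
Proof. by rewrite /ultra_at; case: cid2 => F FU + Lf; apply. Qed.

Lemma hat_cvg f x : LMC f -> f @ ultra_at x --> hat f x.
Proof.
move=> Lf; rewrite hatE //; apply: flim_cvg; last exact: LMC_bounded.
exact: ultra_at_ultra.
Qed.

Lemma ultrafilter_point (F : set_system S) : UltraFilter F ->
  exists x, forall f, LMC f -> hat f x = flim F f.
Proof.
move=> FU; pose m : {ptws LMC -> C} := fun f => flim F (\val f).
have mm : m \in @SLMC_set R S by apply/mem_set/flim_mean => //; exact: LMC_bounded.
by exists (exist _ m mm) => f Lf; rewrite /hat (extend_exist _ (mem_set Lf)).
Qed.

Lemma hat_continuous f : LMC f -> continuous (hat f).
Proof.
move=> Lf x; pose f' : LMC := exist (fun g => g \in LMC) f (mem_set Lf).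
have -> : hat f = (fun m : {ptws LMC -> C} => m f') \o \val.
  by apply/funext => y; rewrite /hat (extend_exist _ (mem_set Lf)).
apply: continuous_comp; first exact: initial_continuous.
exact: (@proj_continuous _ (fun=> C) f').
Qed.

(** The Gelfand topology is initial for the transforms; the proof unfolds the subspace topology and
    the supremum of topologies behind pointwise convergence. *)
Lemma hat_cvgP (F : set_system X) x : Filter F ->
  (forall f, LMC f -> hat f @ F --> hat f x) -> F --> x.
Proof.
move=> FF Fx; have Fv : {ptws, \val @ F --> (\val x : LMC -> C)}.
  apply/cvg_sup => f A [_ [[B Bop <-] Bx] sBA].
  have /Fx : LMC (\val f) by exact: set_valP.
  rewrite /hat extendE (_ : (fun y => _) = fun y : X => \val y f); last first.
    by apply/funext => y; rewrite extendE.
  move=> /(_ B) FB; apply: (@filterS _ F _ _ _ _ (FB _)) => [y By|].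
    exact: sBA.
  exact: open_nbhs_nbhs.
move=> A [_ [[B Bop <-] Bx] sBA].
have /Fv : nbhs (\val x : {ptws LMC -> C}) B by exact: open_nbhs_nbhs.
by apply: (@filterS _ F) => y /sBA.
Qed.

Lemma SLMC_hausdorff : hausdorff_space X.
Proof.
move=> x y xy; apply: hat_inj => f Lf; apply: Cplx_hausdorff => A B nA nB.
have [z [Az Bz]] := xy _ _ (hat_continuous Lf nA) (hat_continuous Lf nB).
by exists (hat f z).
Qed.

(** An ultrafilter on the spectrum, bound with the representatives [ultra_at x], is an ultrafilter
    on [S]; the point it defines is the limit. *)
Lemma SLMC_compact : compact [set: X].
Proof.
rewrite compact_ultra => F FU _.
have [z zF] := ultrafilter_point (filter_bind_ultra FU ultra_at_ultra).
exists z; split => //; apply: hat_cvgP => f Lf.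
rewrite zF //; have [l fl] : exists l : C, hat f @ F --> l.
  have [M fM] := LMC_bounded Lf; apply: (ultra_bounded_cvg FU (M := M)) => x.
  by rewrite hatE //; have xU := ultra_at_ultra x; exact: flim_norm_le.
have bU := filter_bind_ultra FU ultra_at_ultra.
suff -> : flim (filter_bind F ultra_at) f = l by [].
apply: flimE; apply: (filter_bind_cvg FU ultra_at_ultra _ fl) => x.
exact: hat_cvg.
Qed.

Lemma eps_cvg x : @eps R S @ ultra_at x --> x.
Proof.
have xU := ultra_at_ultra x; apply: hat_cvgP => f Lf.
move=> A /(@hat_cvg f x Lf); apply: (@filterS _ (ultra_at x)) => s /=.
by rewrite hat_eps.
Qed.

Lemma eps_dense : dense (range (@eps R S)).
Proof.
move=> O [x Ox] Oop; have /eps_cvg : nbhs x O by exact: open_nbhs_nbhs.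
have xU := ultra_at_ultra x.
by move=> /(@filter_ex _ (ultra_at x))[s Os]; exists (eps R s); split => //; exists s.
Qed.

Lemma eps_continuous : continuous (@eps R S).
Proof.
move=> s; apply: hat_cvgP => f Lf; rewrite hat_eps //.
have /LMCP[[cf _] _] := Lf.
by move=> A /(cf s); apply: (@filterS _ (nbhs s)) => t /=; rewrite hat_eps.
Qed.

Lemma hat_cst c x : hat (fun=> c) x = c.
Proof.
have xU := ultra_at_ultra x.
by rewrite hatE ?flim_cst //; exact: (star_cst LMC_star_algebra).
Qed.

Lemma hat_add f g x : LMC f -> LMC g ->
  hat (fun s => f s + g s) x = hat f x + hat g x.
Proof.
move=> Lf Lg; have xU := ultra_at_ultra x; rewrite !hatE //.
  by rewrite flim_add //; exact: LMC_bounded.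
exact: (star_add LMC_star_algebra).
Qed.

Lemma hat_mul f g x : LMC f -> LMC g ->
  hat (fun s => f s * g s) x = hat f x * hat g x.
Proof.
move=> Lf Lg; have xU := ultra_at_ultra x; rewrite !hatE //.
  by rewrite flim_mul //; exact: LMC_bounded.
exact: (star_mul LMC_star_algebra).
Qed.

Lemma hat_conj f x : LMC f -> hat (fun s => (f s)^*) x = (hat f x)^*.
Proof.
move=> Lf; have xU := ultra_at_ultra x; rewrite !hatE //.
  by rewrite flim_conj //; exact: LMC_bounded.
exact: (star_conj LMC_star_algebra).
Qed.

(** The sublevel sets of transforms vanishing at [x] form a filter. It converges to [x], by
    rescaling [hat f x - f], so each neighbourhood contains one such set. *)
Lemma SLMC_nbhs_base x (O : set X) : nbhs x O ->
  exists g, [/\ LMC g, hat g x = 0 & [set y | `|hat g y| < 1] `<=` O].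
Proof.
pose B := [set hat g | g in [set g | LMC g /\ hat g x = 0]].
have FB : Filter (sublevel_filter B).
  apply: sublevel_filterP => [|_ _ [g [Lg gx] <-] [h [Lh hx] <-]].
    exists (fun=> 0); last by apply/funext => y; rewrite hat_cst.
    by split; [exact: (star_cst LMC_star_algebra)|exact: hat_cst].
  have Lgg := star_mul LMC_star_algebra Lg (star_conj LMC_star_algebra Lg).
  have Lhh := star_mul LMC_star_algebra Lh (star_conj LMC_star_algebra Lh).
  have ghE y : hat (fun s => g s * (g s)^* + h s * (h s)^*) y =
      hat g y * (hat g y)^* + hat h y * (hat h y)^*.
    rewrite (hat_add _ Lgg Lhh) (hat_mul _ Lg (star_conj LMC_star_algebra Lg)).
    by rewrite (hat_mul _ Lh (star_conj LMC_star_algebra Lh)) !hat_conj.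
  exists (fun s => g s * (g s)^* + h s * (h s)^*); last exact/funext.
  split; first exact: (star_add LMC_star_algebra Lgg Lhh).
  by rewrite ghE gx hx !mul0r addr0.
suff Bx : sublevel_filter B --> x by move=> /Bx[_ [g [Lg gx] <-]] ?; exists g.
apply: hat_cvgP => f Lf; apply/(@cvgrPdist_lt _ _ _ _ FB) => e e0.
pose g s := - e^-1 * f s + e^-1 * hat f x.
have Lef : LMC (fun s => - e^-1 * f s).
  exact: (star_mul LMC_star_algebra (star_cst LMC_star_algebra _) Lf).
have Lg : LMC g.
  exact: (star_add LMC_star_algebra Lef (star_cst LMC_star_algebra _)).
have gE y : hat g y = e^-1 * (hat f x - hat f y).
  rewrite /g (hat_add _ Lef (star_cst LMC_star_algebra _)) hat_cst.
  rewrite (hat_mul _ (star_cst LMC_star_algebra _) Lf) hat_cst.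
  by rewrite mulNr addrC -mulrBr.
exists (hat g); first by exists g => //; split => //; rewrite gE subrr mulr0.
move=> y /=; rewrite gE normrM (gtr0_norm (_ : 0 < e^-1)) ?invr_gt0 //.
by rewrite mulrC ltr_pdivrMr // mul1r.
Qed.

End Spectrum.

(** * Zero sets and their closures *)

Section ZeroSets.
Context {R : realType} {S : semitopologicalSemigroupType}.
Local Notation C := (Cplx R).
Local Notation LMC := (@LMC R S).
Local Notation X := (SLMC R S).
Local Notation zero_sets := (@zero_sets R S).
Local Notation cl := (@cl R S).
Local Notation algL := (@LMC_star_algebra R S).
Implicit Types (A B : set S) (x y : X).

Lemma zero_setsT : zero_sets setT.
Proof.
exists (fun=> 0); first exact: (star_cst algL).
by apply/seteqP; split => s.
Qed.

Lemma zero_sets0 : zero_sets set0.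
Proof.
exists (fun=> 1); first exact: (star_cst algL).
by apply/seteqP; split => s //= /eqP; rewrite oner_eq0.
Qed.

Lemma zero_setsI A B : zero_sets A -> zero_sets B -> zero_sets (A `&` B).
Proof.
move=> [f Lf ->] [g Lg ->]; exists (fun s => `|f s| + `|g s|).
  exact: (star_add algL (LMC_norm Lf) (LMC_norm Lg)).
apply/seteqP; split => s /=; first by case=> -> ->; rewrite normr0 addr0.
move/eqP; rewrite paddr_eq0 // !normr_eq0 => /andP[/eqP ? /eqP ?].
by split.
Qed.

Lemma zero_setsU A B : zero_sets A -> zero_sets B -> zero_sets (A `|` B).
Proof.
move=> [f Lf ->] [g Lg ->]; exists (fun s => f s * g s).
  exact: (star_mul algL Lf Lg).
apply/seteqP; split => s /=; first by case=> ->; rewrite ?mulr0 ?mul0r.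
by move/eqP; rewrite mulf_eq0 => /orP[/eqP|/eqP]; [left|right].
Qed.

(** The set is where [f + |f|] vanishes. *)
Lemma zero_set_pos (f : S -> C) : LMC f -> (forall s, f s \is Num.real) ->
  zero_sets [set s | f s <= 0].
Proof.
move=> Lf fr; exists (fun s => f s + `|f s|).
  exact: (star_add algL Lf (LMC_norm Lf)).
apply/seteqP; split => s /=; first by move/ler0_norm ->; rewrite subrr.
by rewrite addrC => /eqP; rewrite addr_eq0 ler0_def.
Qed.

Lemma zero_set_le (g : S -> C) (c : C) : LMC g -> c \is Num.real ->
  zero_sets [set s | `|g s| <= c].
Proof.
move=> Lg cr; have Lgc := star_add algL (LMC_norm Lg) (star_cst algL (- c)).
rewrite (_ : mkset _ = [set s | `|g s| - c <= 0]).
  by apply: zero_set_pos => // s; rewrite realB ?normr_real.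
by apply/seteqP; split => s /=; rewrite subr_le0.
Qed.

Lemma zero_set_ge (g : S -> C) (c : C) : LMC g -> c \is Num.real ->
  zero_sets [set s | c <= `|g s|].
Proof.
move=> Lg cr; have Lgc := star_add algL (star_cst algL c)
  (star_mul algL (star_cst algL (-1)) (LMC_norm Lg)).
rewrite (_ : mkset _ = [set s | c + -1 * `|g s| <= 0]).
  by apply: zero_set_pos => // s; rewrite mulN1r realB ?normr_real.
by apply/seteqP; split => s /=; rewrite mulN1r subr_le0.
Qed.

Lemma cl_closed A : closed (cl A).
Proof. exact: closed_closure. Qed.

Lemma clS A B : A `<=` B -> cl A `<=` cl B.
Proof. by move=> AB; apply: closureS; exact: image_subset. Qed.

Lemma clU A B : cl (A `|` B) = cl A `|` cl B.
Proof. by rewrite /Defs.cl image_setU closureU. Qed.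

Lemma cl0 : cl set0 = set0.
Proof. by rewrite /Defs.cl image_set0 closure0. Qed.

Lemma cl_eps A s : A s -> cl A (eps R s).
Proof. by move=> As; apply: subset_closure; exists s. Qed.

Lemma cl_meet A (O : set X) x : cl A x -> nbhs x O ->
  exists2 s, A s & O (eps R s).
Proof. by move=> Ax /Ax[_ [[s As <-] Os]]; exists s. Qed.

Lemma cl_norm_le (g : S -> C) (c : C) x : LMC g -> c \is Num.real ->
  cl [set s | `|g s| <= c] x -> `|hat g x| <= c.
Proof.
move=> Lg cr clx; rewrite real_leNgt ?normr_real //; apply/negP => gx.
have gnear : \forall y \near x, c < `|hat g y|.
  exact: (@cvgr_norm_gt _ _ _ (nbhs x) _ _ _ (hat_continuous Lg (x := x)) _ gx).
have [s /= gs] := cl_meet clx gnear.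
by rewrite hat_eps // real_ltNge ?normr_real // gs.
Qed.

Lemma cl_norm_ge (g : S -> C) (c : C) x : LMC g -> c \is Num.real ->
  cl [set s | c <= `|g s|] x -> c <= `|hat g x|.
Proof.
move=> Lg cr clx; rewrite real_leNgt ?normr_real //; apply/negP => gx.
have gnear : \forall y \near x, `|hat g y| < c.
  exact: (@cvgr_norm_lt _ _ _ (nbhs x) _ _ _ (hat_continuous Lg (x := x)) _ gx).
have [s /= gs] := cl_meet clx gnear.
by rewrite hat_eps // real_ltNge ?normr_real // gs.
Qed.

Lemma cl_hat0 (f : S -> C) x : LMC f -> cl (f @^-1` [set 0]) x -> hat f x = 0.
Proof.
move=> Lf fx; apply/eqP; rewrite -normr_le0; apply: cl_norm_le => //.
by apply: clS fx => s /= ->; rewrite normr0.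
Qed.

Lemma cl_zero_set A s : zero_sets A -> cl A (eps R s) -> A s.
Proof. by move=> [f Lf ->] /(cl_hat0 Lf); rewrite hat_eps. Qed.

(** By density, every neighbourhood of a point of [U] contains some [eps s] in [U], and then [s] is
    in [A]. *)
Lemma open_interior_cl (U : set X) A : open U ->
  (forall s, U (eps R s) -> A s) -> U `<=` (cl A)°.
Proof.
move=> Uop UA; rewrite -open_subsetE // => x Ux O.
rewrite nbhsE => -[V [Vop Vx] VO].
have [|z [[Uz Vz] [s _ sz]]] := @eps_dense R S (U `&` V) _ (openI Uop Vop).
  by exists x.
rewrite -sz in Uz Vz; exists (eps R s); split; last exact: VO.
by exists s => //; exact: UA.
Qed.

(** A zero set is the trace of its closure on [S], so the open left side has its trace inside [A]
    and [B]. *)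
Lemma interior_clI A B : zero_sets A -> zero_sets B ->
  (cl A)° `&` (cl B)° `<=` (cl (A `&` B))°.
Proof.
move=> ZA ZB; apply: open_interior_cl => [|s [As Bs]].
  by apply: openI; exact: open_interior.
by split; apply: cl_zero_set => //; exact: interior_subset.
Qed.

Lemma interior_clS A B : A `<=` B -> (cl A)° `<=` (cl B)°.
Proof. by move=> AB; apply: interiorS; exact: clS. Qed.

Lemma cl_interior_meet A B x : zero_sets B -> cl A x -> (cl B)° x ->
  A `&` B !=set0.
Proof.
move=> ZB Ax Bx; have [s As Bs] := cl_meet Ax Bx.
by exists s; split => //; exact: cl_zero_set.
Qed.

(** The zero set where [|g| <= 1/2] leaves room on both sides: its closure contains the open set
    where [|hat g| < 1/2] and lies where [|hat g| < 1]. *)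
Lemma zero_set_nbhs x (O : set X) : nbhs x O ->
  exists A, [/\ zero_sets A, (cl A)° x & cl A `<=` O].
Proof.
move=> /SLMC_nbhs_base[g [Lg gx gO]].
have half_real : (2^-1 : C) \is Num.real by rewrite ger0_real // invr_ge0 ler0n.
exists [set s | `|g s| <= 2^-1]; split => [|/=|y]; first exact: zero_set_le.
  have Uop : open [set y | `|hat g y| < 2^-1].
    rewrite openE => y /= gy.
    exact: (@cvgr_norm_lt _ _ _ (nbhs y) _ _ _ (hat_continuous Lg (x := y)) _ gy).
  apply: (open_interior_cl Uop) => [s /=|/=]; first by rewrite hat_eps // => /ltW.
  by rewrite gx normr0 invr_gt0.
move=> /(cl_norm_le Lg half_real) gy; apply: gO => /=.
by rewrite (le_lt_trans gy) // invf_lt1 // ltr1n.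
Qed.

Lemma open_setC1 x : open (~` [set x]).
Proof.
apply: closed_openC; apply: compact_closed; last exact: compact_set1.
exact: SLMC_hausdorff.
Qed.

Lemma compact_directed (I : Type) (D : set I) (K : I -> set X) :
    D !=set0 -> (forall i, D i -> closed (K i)) ->
    (forall i, D i -> K i !=set0) ->
    (forall i j, D i -> D j -> exists2 k, D k & K k `<=` K i `&` K j) ->
  exists x, forall i, D i -> K i x.
Proof.
move=> [i0 Di0] Kcl K0 Kdir; have FF : ProperFilter (filter_from D K).
  apply: filter_from_proper => //; apply: filter_from_filter => //.
  by exists i0.
have [//|x [_ Fx]] := @SLMC_compact R S _ FF; first exact: filterT.
exists x => i Di; apply: Kcl => // O xO.
by apply: Fx => //; exists i.
Qed.

(** The zero sets with closure in [U] are closed under union. If none had [K] in its interior,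
    compactness would give a point of [K] outside all these interiors, against [zero_set_nbhs]. *)
Lemma zero_set_between (K U : set X) : closed K -> open U -> K `<=` U ->
  exists A, [/\ zero_sets A, K `<=` (cl A)° & cl A `<=` U].
Proof.
move=> Kcl Uop KU; apply: contrapT => noA.
have [||||x KA] := @compact_directed _ [set A | zero_sets A /\ cl A `<=` U]
    (fun A => K `\` (cl A)°).
- exists set0; split; last by rewrite cl0.
  exact: zero_sets0.
- move=> A _; rewrite setDE; apply: closedI => //.
  by apply: open_closedC; exact: open_interior.
- move=> A [ZA AU]; apply: contrapT => KA; apply: noA; exists A; split => //.
  by move=> x Kx; apply: contrapT => Ax; apply: KA; exists x.
- move=> A B [ZA AU] [ZB BU]; exists (A `|` B).
    by split; [exact: zero_setsU|rewrite clU subUset].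
  move=> x [Kx ABx]; split; split => // Ax; apply: ABx.
    exact: (interior_clS (@subsetUl _ A B) Ax).
  exact: (interior_clS (@subsetUr _ A B) Ax).
have [|Kx _] := KA set0; first by split; rewrite ?cl0 //; exact: zero_sets0.
have [A [ZA Ax AU]] := zero_set_nbhs (open_nbhs_nbhs (conj Uop (KU _ Kx))).
by have [] := KA A (conj ZA AU).
Qed.

End ZeroSets.

(** * z-filters and their hulls *)

Section ZFilters.
Context {R : realType} {S : semitopologicalSemigroupType}.
Local Notation C := (Cplx R).
Local Notation LMC := (@LMC R S).
Local Notation X := (SLMC R S).
Local Notation zero_sets := (@zero_sets R S).
Local Notation cl := (@cl R S).
Local Notation zfilter := (@zfilter R S).
Local Notation zultrafilter := (@zultrafilter R S).
Local Notation zlim := (@zlim R S).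
Local Notation hull := (@hull R S).
Implicit Types (A B : set S) (x y : X) (F G p q : set (set S)).

Lemma zfilter_join F G : zfilter F -> zfilter G ->
  (forall A B, F A -> G B -> A `&` B !=set0) ->
  exists H, [/\ zfilter H, F `<=` H & G `<=` H].
Proof.
move=> [FZ FT F0 FI FS] [GZ GT G0 GI GS] FG.
exists [set D | zero_sets D /\ exists A B, [/\ F A, G B & A `&` B `<=` D]].
split.
- split.
  + by move=> D [].
  + by split; [exact: zero_setsT|exists setT, setT].
  + by move=> [_ [A [B [FA GB AB]]]]; have [s /AB] := FG _ _ FA GB.
  + move=> D E [ZD [A [B [FA GB AB]]]] [ZE [A' [B' [FA' GB' AB']]]].
    split; first exact: zero_setsI.
    exists (A `&` A'), (B `&` B'); split; [exact: FI|exact: GI|].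
    by move=> s [[As A's] [Bs B's]]; split; [apply: AB|apply: AB'].
  + move=> D E ZE DE [ZD [A [B [FA GB AB]]]]; split => //.
    by exists A, B; split => //; exact: subset_trans AB DE.
- move=> A FA; split; first exact: FZ.
  by exists A, setT; split => // s [].
- move=> B GB; split; first exact: GZ.
  by exists setT, B; split => // s [].
Qed.

Lemma zultrafilter_exists F : zfilter F ->
  exists2 p, zultrafilter p & F `<=` p.
Proof.
(* Joining [F] to [q] makes the empty chain harmless in Zorn's lemma: its union is empty and [F]
   itself is a z-filter. *)
move=> ZF; pose P q := zfilter (F `|` q).
have [|p [Pp pmax]] := @Zorn_bigcup _ P.
  move=> Q QP Qtot; rewrite /P; have [FZ FT F0 FI FS] := ZF.
  split.
  - move=> A [/FZ//|[q Qq qA]]; have [+ _ _ _ _] := QP q Qq.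
    by apply; right.
  - by left.
  - move=> [//|[q Qq q0]]; have [_ _ + _ _] := QP q Qq.
    by apply; right.
  - move=> A B [FA|[q Qq qA]] [FB|[r Qr rB]].
    + by left; exact: FI.
    + have [_ _ _ + _] := QP r Qr => /(_ A B (or_introl FA) (or_intror rB)).
      by case; [left|right; exists r].
    + have [_ _ _ + _] := QP q Qq => /(_ A B (or_intror qA) (or_introl FB)).
      by case; [left|right; exists q].
    + have [qr|rq] := Qtot _ _ Qq Qr.
        have [_ _ _ + _] := QP r Qr.
        move=> /(_ A B (or_intror (qr _ qA)) (or_intror rB)).
        by case; [left|right; exists r].
      have [_ _ _ + _] := QP q Qq.
      move=> /(_ A B (or_intror qA) (or_intror (rq _ rB))).
      by case; [left|right; exists q].
  - move=> A B ZB AB [FA|[q Qq qA]]; first by left; exact: FS AB FA.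
    have [_ _ _ _ +] := QP q Qq => /(_ A B ZB AB (or_intror qA)).
    by case; [left|right; exists q].
exists (F `|` p); last exact: subsetUl.
split => // q Zq Fpq; apply: contrapT => qne; apply: (pmax q).
  split; first by apply: subset_trans Fpq; exact: subsetUr.
  move=> qp; apply: qne; apply/seteqP; split => // A /qp; by right.
rewrite /P (_ : _ `|` _ = q) //; apply/setUidPr.
by apply: subset_trans Fpq; exact: subsetUl.
Qed.

(** If [A] met every member of [p], the join of [p] with the zero sets containing [A] would
    contradict maximality. *)
Lemma zultrafilter_disjoint p A : zultrafilter p -> zero_sets A -> ~ p A ->
  exists2 B, p B & A `&` B = set0.
Proof.
move=> [Zp pmax] ZA pA; apply: contrapT => noB.
have AB B : p B -> A `&` B !=set0.
  by move=> pB; apply/set0P/eqP => AB0; apply: noB; exists B.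
have ZGA : zfilter [set D | zero_sets D /\ A `<=` D].
  have [_ pT _ _ _] := Zp; split.
  - by move=> D [].
  - by split; [exact: zero_setsT|].
  - by move=> [_ A0]; have [s [/A0]] := AB _ pT.
  - by move=> D E [ZD AD] [ZE AE]; split; [exact: zero_setsI|rewrite subsetI].
  - by move=> D E ZE DE [_ AD]; split => //; exact: subset_trans AD DE.
have [B D pB [_ AD]|H [ZH pH AH]] := zfilter_join Zp ZGA.
  by have [s [As Bs]] := AB _ pB; exists s; split => //; exact: AD.
by apply: pA; rewrite -(pmax _ ZH pH); apply: AH; split.
Qed.

Lemma zultrafilter_prime p A B : zultrafilter p -> zero_sets A -> zero_sets B ->
  A `|` B = setT -> p A \/ p B.
Proof.
move=> pU ZA ZB AB; apply: contrapT => /not_orP[pA pB].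
have [D pD AD] := zultrafilter_disjoint pU ZA pA.
have [E pE BE] := zultrafilter_disjoint pU ZB pB.
have [[_ _ p0 pI _] _] := pU; apply: p0.
rewrite (_ : set0 = D `&` E); first exact: pI.
apply/seteqP; split => s //= [Ds Es].
have [As|Bs] : (A `|` B) s by rewrite AB.
  by have : (A `&` D) s by []; rewrite AD.
by have : (B `&` E) s by []; rewrite BE.
Qed.

Lemma zfilter_bigcap_cl F : zfilter F -> exists x, (\bigcap_(A in F) cl A) x.
Proof.
move=> [FZ FT F0 FI FS]; apply: (@compact_directed R S _ F cl).
- by exists setT.
- by move=> A _; exact: cl_closed.
- move=> A FA; apply/set0P/eqP => A0; apply: F0; suff -> : set0 = A by [].
  apply/seteqP; split => // s As; have : cl A (eps R s) by exact: cl_eps.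
  by rewrite A0.
- move=> A B FA FB; exists (A `&` B); first exact: FI.
  by move=> x ABx; split; apply: clS ABx; [exact: subIsetl|exact: subIsetr].
Qed.

(** For [y] other than [x], take [g] with [hat g y = 0] and [|hat g x| >= 1]. By primeness [p]
    contains the set where [|g| <= 1/2] or the one where [|g| >= 1/2]; the first excludes [x], the
    second [y]. *)
Lemma zlim_set1 p x : zultrafilter p -> zlim p x -> zlim p = [set x].
Proof.
move=> pU px; apply/seteqP; split=> [y py|_ -> //] /=.
apply: contrapT => /eqP yx.
have : open_nbhs y (~` [set x]).
  by split; [exact: open_setC1|apply/eqP].
move=> /open_nbhs_nbhs/SLMC_nbhs_base[g [Lg gy gx]].
have half_real : (2^-1 : C) \is Num.real by rewrite ger0_real // invr_ge0 ler0n.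
have half1 : (2^-1 : C) < 1 by rewrite invf_lt1 // ltr1n.
have [|pA|pB] := zultrafilter_prime pU (zero_set_le Lg half_real)
    (zero_set_ge Lg half_real).
- apply/seteqP; split => // s _ /=; apply/orP.
  by rewrite real_leVge ?normr_real.
- apply: (gx x) => //=; apply: le_lt_trans half1.
  by apply: cl_norm_le => //; exact: px.
- have := cl_norm_ge Lg half_real (py _ pB).
  by rewrite gy normr0 invr_le0 real_leNgt ?real0 // ltr0n.
Qed.

Definition nbhs_zfilter x := [set A | zero_sets A /\ (cl A)° x].

Lemma nbhs_zfilterP x : zfilter (nbhs_zfilter x).
Proof.
split.
- by move=> A [].
- split; first exact: zero_setsT.
  by apply: (open_interior_cl openT).
- by move=> [_ /interior_subset]; rewrite cl0.
- by move=> A B [ZA Ax] [ZB Bx]; split; [exact: zero_setsI|exact: interior_clI].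
- by move=> A B ZB AB [ZA Ax]; split => //; exact: interior_clS Ax.
Qed.

Lemma zlim_of_nbhs p x : zultrafilter p -> nbhs_zfilter x `<=` p ->
  zlim p = [set x].
Proof.
move=> pU xp; have [Zp _] := pU.
have [y py] := zfilter_bigcap_cl Zp.
rewrite (zlim_set1 pU py); congr [set _]; apply: contrapT => yx.
have : open_nbhs x (~` [set y]).
  by split; [exact: open_setC1|move=> /= xy; apply: yx].
move=> /open_nbhs_nbhs/zero_set_nbhs[A [ZA Ax Ay]].
by apply: (Ay y) => //; apply: py; apply: xp.
Qed.

(** If [x] is in all these closures, [F] and the neighbourhood z-filter of [x] have a join, and any
    z-ultrafilter above it has limit [x]. *)
Lemma hullE F : zfilter F -> hull F = \bigcap_(A in F) cl A.
Proof.
move=> ZF; apply/seteqP; split=> [x [p [pU Fp px]] A FA|x Fx].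
  have pxx : zlim p x by rewrite px.
  exact: pxx (Fp _ FA).
have [A B FA [ZB Bx]|H [ZH FH xH]] := zfilter_join ZF (nbhs_zfilterP x).
  by apply: (cl_interior_meet ZB _ Bx); exact: Fx.
have [p pU Hp] := zultrafilter_exists ZH; exists p; split => //.
  exact: subset_trans FH Hp.
by apply: zlim_of_nbhs => //; exact: subset_trans xH Hp.
Qed.

Lemma hull_closed F : zfilter F -> closed (hull F).
Proof. by move=> /hullE ->; apply: closed_bigI => A _; exact: cl_closed. Qed.

Lemma hull_nonempty F : zfilter F -> hull F !=set0.
Proof. by move=> ZF; rewrite hullE //; exact: zfilter_bigcap_cl. Qed.

(** By compactness some [B] in [F] has its closure inside the interior of [cl A]; taking traces on
    [S], [B] is contained in [A]. *)
Lemma hull_interior F A : zfilter F -> zero_sets A ->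
  hull F `<=` (cl A)° -> F A.
Proof.
move=> ZF ZA FA; have [FZ FT F0 FI FS] := ZF; apply: contrapT => nFA.
have [||||x Fx] := @compact_directed R S _ F (fun B => cl B `\` (cl A)°).
- by exists setT.
- move=> B _; rewrite setDE; apply: closedI; first exact: cl_closed.
  by apply: open_closedC; exact: open_interior.
- move=> B FB; apply: contrapT => BA; apply: nFA; apply: (FS B) => //.
  move=> s Bs; apply: (cl_zero_set ZA); apply: interior_subset.
  by apply: contrapT => As; apply: BA; exists (eps R s); split => //; exact: cl_eps.
- move=> B D FB FD; exists (B `&` D); first exact: FI.
  move=> x [BDx Ax]; split; split => //; apply: clS BDx; first exact: subIsetl.
  exact: subIsetr.
have : hull F x by rewrite hullE // => B /Fx[].
by move=> /FA; have [] := Fx _ FT.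
Qed.

Lemma hull_zinterior F (U : set X) : zfilter F -> open U -> hull F `<=` U ->
  exists2 A, zinterior R F A & cl A `<=` U.
Proof.
move=> ZF Uop FU; have [A [ZA FA AU]] := zero_set_between (hull_closed ZF) Uop FU.
by exists A => //; split => //; exact: hull_interior.
Qed.

(** From left to right, a z-ultrafilter above the neighbourhood z-filter of [x] is a witness; from
    right to left, purity spreads [F] to all z-ultrafilters with limit [x]. *)
Lemma pure_sub_point F x : pure R F -> F `<=` point_zfilter x <-> hull F x.
Proof.
move=> pF; split=> [Fx|[p [pU Fp px]] A FA q [qU qx]].
  have [p pU xp] := zultrafilter_exists (nbhs_zfilterP x).
  exists p; split => //; last exact: zlim_of_nbhs.
  by move=> A /Fx; apply; split => //; exact: zlim_of_nbhs.
by apply: (pF p pU Fp A FA); split => //; rewrite px.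
Qed.

End ZFilters.

(** * The product of the spectrum *)

Section SpectrumProduct.
Context {R : realType} {S : semitopologicalSemigroupType}.
Local Notation C := (Cplx R).
Local Notation LMC := (@LMC R S).
Local Notation X := (SLMC R S).
Implicit Types (x y z : X) (f : S -> C).

(* The function T_y f. *)
Definition introversion y f : S -> C := fun s => hat (ltrans s f) y.

Lemma LMC_introversion y f : LMC f -> LMC (introversion y f).
Proof.
move=> Lf; have yU := ultra_at_ultra y.
rewrite (_ : introversion y f = fun s => flim (ultra_at y) (ltrans s f)).
  exact: LMC_flim.
by apply/funext => s; rewrite /introversion hatE //; exact: LMC_ltrans.
Qed.

(** The point is defined by the bind of [ultra_at x] with the left translates of [ultra_at y]. *)
Lemma spectrum_mul_exists x y :
  exists z, forall f, LMC f -> hat f z = hat (introversion y f) x.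
Proof.
have yU (t : S) : UltraFilter ((fun r => t * r)%g @ ultra_at y).
  by apply: ultra_fmap; exact: ultra_at_ultra.
have xU := ultra_at_ultra x; have xyU := filter_bind_ultra xU yU.
have [z zE] := @ultrafilter_point R _ _ xyU; exists z => f Lf; rewrite zE //.
have fy (t : S) : f @ ((fun r => t * r)%g @ ultra_at y) --> introversion y f t.
  exact: (@hat_cvg _ _ _ y (LMC_ltrans t Lf)).
have fxy := @hat_cvg _ _ _ x (LMC_introversion y Lf).
have bF : ProperFilter _ := @ultra_proper _ _ xyU.
exact: (flimE bF (filter_bind_cvg xU yU fy fxy)).
Qed.

(* The limit of s t as t tends to y along one ultrafilter and then s tends to x
   along another; on LMC(S) this is x composed with T_y. *)
Definition spectrum_mul x y : X := projT1 (cid (spectrum_mul_exists x y)).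

Lemma hat_spectrum_mul f x y : LMC f ->
  hat f (spectrum_mul x y) = hat (introversion y f) x.
Proof. by rewrite /spectrum_mul; case: cid => z zE /zE. Qed.

Lemma hat_mul_eps f s y : LMC f ->
  hat f (spectrum_mul (eps R s) y) = hat (ltrans s f) y.
Proof.
move=> Lf; rewrite hat_spectrum_mul // hat_eps //.
exact: LMC_introversion.
Qed.

(** Both sides evaluate [T_y (T_z f)] at [x], since [T_(yz) f = T_y (T_z f)]. *)
Lemma spectrum_mulA : associative spectrum_mul.
Proof.
move=> x y z; apply: hat_inj => f Lf.
have Lzf := LMC_introversion z Lf.
rewrite hat_spectrum_mul // [RHS]hat_spectrum_mul // [RHS]hat_spectrum_mul //.
congr hat; apply/funext => s; rewrite /introversion.
rewrite hat_spectrum_mul; last exact: LMC_ltrans.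
by congr hat; apply/funext => t; rewrite /introversion ltransM.
Qed.

Lemma spectrum_mul_continuous y : continuous (fun x => spectrum_mul x y).
Proof.
move=> x; apply: (@hat_cvgP _ _ _ _ (fmap_filter _ (nbhs_filter x))) => f Lf.
rewrite hat_spectrum_mul //.
have Lyf := LMC_introversion y Lf.
move=> A /(hat_continuous Lyf); apply: (@filterS _ (nbhs x)) => z /=.
by rewrite hat_spectrum_mul.
Qed.

Lemma eps_mul_continuous s : continuous (spectrum_mul (eps R s)).
Proof.
move=> y; apply: (@hat_cvgP _ _ _ _ (fmap_filter _ (nbhs_filter y))) => f Lf.
rewrite hat_mul_eps //.
have Lsf := LMC_ltrans s Lf.
move=> A /(hat_continuous Lsf); apply: (@filterS _ (nbhs y)) => z /=.
by rewrite hat_mul_eps.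
Qed.

Lemma epsM s t : eps R (s * t)%g = spectrum_mul (eps R s) (eps R t).
Proof.
apply: hat_inj => f Lf; rewrite hat_mul_eps // !hat_eps //.
exact: LMC_ltrans.
Qed.

(** If [xy] were outside [cl A], some [g] would have [hat g (xy) = 0] and [|hat g| >= 1] on [cl A].
    Then [|T_y g| >= 1] on [Omega G A], so the zero set given by this inequality is in [F], and
    evaluating at [x] gives [|hat g (xy)| >= 1]. *)
Lemma bigcap_zadd (F G : set (set S)) x y : zfilter R F -> zfilter R G ->
  hull F x -> hull G y -> (\bigcap_(A in zadd R F G) @cl R S A) (spectrum_mul x y).
Proof.
move=> ZF ZG; rewrite !hullE // => Fx Gy A [ZA FA].
apply: contrapT => nA; have : nbhs (spectrum_mul x y) (~` @cl R S A).
  by apply: open_nbhs_nbhs; split => //; apply: closed_openC; exact: cl_closed.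
move=> /SLMC_nbhs_base[g [Lg gxy gA]].
have gA1 z : @cl R S A z -> 1 <= `|hat g z|.
  by move=> Az; apply: real_ltPge1 => gz; exact: (gA z gz).
have half_real : (2^-1 : C) \is Num.real by rewrite ger0_real // invr_ge0 ler0n.
have Lyg := LMC_introversion y Lg.
have FH : F [set s | 1 <= `|introversion y g s|].
  apply: FA; first by apply: zero_set_ge => //; exact: real1.
  (* [y] is a limit of points [t] with [s t] in [A], so continuity of left multiplication by [eps s]
     puts [eps s] times [y] in [cl A]. *)
  move=> s Gs /=; rewrite /introversion -hat_mul_eps //; apply: gA1 => O.
  move=> /(eps_mul_continuous (x := y)) yO.
  have [t /= At Ot] := cl_meet (Gy _ Gs) yO.
  exists (eps R (s * t)%g); rewrite epsM; split => //.
  by exists (s * t)%g; rewrite // epsM.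
have := cl_norm_ge Lyg (real1 _) (Fx _ FH).
by rewrite -hat_spectrum_mul // gxy normr0 ler10.
Qed.

End SpectrumProduct.

(** * Quotients of the spectrum *)

Section Quotient.
Context {R : realType} {S : semitopologicalSemigroupType}.
Context {Gamma : set (set (set S))} (quotG : is_quotient R Gamma).
Local Notation X := (SLMC R S).
Local Notation Q := (quotient_space R Gamma).
Local Notation cl := (@cl R S).
Local Notation hull := (@hull R S).
Implicit Types (L K : Q) (x y : X).

Lemma quotient_zfilter L : zfilter R (\val L).
Proof. by have [/(_ _ (set_valP L))[]] := quotG. Qed.

Lemma quotient_pure L : pure R (\val L).
Proof. by have [/(_ _ (set_valP L))[]] := quotG. Qed.

(** A point in no hull could be avoided by the closures of a whole topological choice, against the
    finite cover in condition (i). *)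
Lemma quotient_cover x : exists L, hull (\val L) x.
Proof.
apply: contrapT => /forallNP noL; have [_ finG _] := quotG.
have /choice[f fP] (L : Gamma) :
    exists A, zinterior R (\val L) A /\ cl A `<=` ~` [set x].
  have [|A LA Ax] := hull_zinterior (quotient_zfilter L) (open_setC1 x);
    last by exists A.
  by move=> y Ly yx; apply: (noL L); rewrite -yx.
have [L|F _ Fcov] := finG f.
  have [[LA LU] _] := fP L; split => //; exists (\val L) => //.
  exact: set_valP.
have : (\bigcup_(L in F) (cl (f L))°) x by rewrite Fcov.
by move=> [L _ /interior_subset Lx]; have [_ /(_ x Lx)] := fP L; apply.
Qed.

(** Condition (ii) in topological form, with the interiors of [cl A] and [cl B] as [U] and [V]. *)
Lemma quotient_separation L K : L <> K -> exists U V : set X,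
  [/\ open U, open V, hull (\val L) `<=` U, hull (\val K) `<=` V &
      forall M : Q, hull (\val M) `&` U = set0 \/ hull (\val M) `&` V = set0].
Proof.
move=> LK; have [_ _ sepG] := quotG.
have [|A [B [[LA AU] [KB BU] AB]]] :=
    sepG _ _ (set_valP L) (set_valP K); first by move/val_inj.
exists (cl A)°, (cl B)°; split=> //; [exact: open_interior|exact: open_interior|].
(* For [x] in [U], a zero set [H] squeezed between the complement of [U] and that of [x] belongs to
   [M], and its closure misses [x]. *)
have avoid (M : Q) (U : set X) : open U ->
    (forall H, zero_sets R H -> ~` U `<=` (cl H)° -> \val M H) ->
    hull (\val M) `&` U = set0.
  move=> Uop UM; apply/seteqP; split => // x [Mx Ux].
  have [|||H [ZH UH Hx]] := @zero_set_between R S (~` U) (~` [set x]).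
  - exact: open_closedC.
  - exact: open_setC1.
  - by move=> y Uy /= yx; apply: Uy; rewrite yx.
  move: Mx; rewrite (hullE (quotient_zfilter M)) => /(_ _ (UM _ ZH UH)).
  by move/Hx; apply.
move=> M.
(* Condition (ii) treats [H] and [T] together: a single [H] failing the first alternative yields the
   second for every [T]. *)
have [MA|] := pselect (forall H, zero_sets R H ->
    ~` (cl A)° `<=` (cl H)° -> \val M H).
  by left; apply: avoid => //; exact: open_interior.
move=> /existsNP[H /not_implyP[ZH /not_implyP[AH MH]]]; right.
apply: avoid => [|T ZT BT]; first exact: open_interior.
by have [/(_ AH)//|] := AB _ H T (set_valP M) ZH ZT; apply.
Qed.

Lemma quotient_hull_inj L K x : hull (\val L) x -> hull (\val K) x -> L = K.
Proof.
move=> Lx Kx; apply: contrapT => /quotient_separation[U [V [_ _ LU KV UV]]].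
have [L0|L0] := UV L.
  suff : set0 x by []; rewrite -L0; split => //; exact: LU.
suff : set0 x by []; rewrite -L0; split => //; exact: KV.
Qed.

(** The map gamma, defined by hulls; [pure_sub_point] identifies this with containment of
    z-filters. *)
Definition quotient_map x : Q := projT1 (cid (quotient_cover x)).

Lemma quotient_map_hull x : hull (\val (quotient_map x)) x.
Proof. by rewrite /quotient_map; case: cid. Qed.

Lemma hull_quotient_map L x : hull (\val L) x <-> L = quotient_map x.
Proof.
split=> [Lx|->]; last exact: quotient_map_hull.
exact: quotient_hull_inj Lx (quotient_map_hull x).
Qed.

Lemma quotient_map_surj L : exists x, quotient_map x = L.
Proof.
have [x Lx] := hull_nonempty (quotient_zfilter L); exists x.
exact/esym/hull_quotient_map.
Qed.

(** For [y] outside the saturation, consider pairs of open sets [U], [V] with [y] in [V] such that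
    no hull meets both. If some [U] contains [K], its [V] misses the saturation. Otherwise
    compactness gives a point of [K] in no such [U], against the separation of its class from that
    of [y]. *)
Lemma closed_saturation (K : set X) : closed K ->
  closed [set y | exists2 x, K x & quotient_map x = quotient_map y].
Proof.
move=> Kcl; rewrite -openC openE => y /= ny.
pose D := [set UV : set X * set X | [/\ open UV.1, open UV.2, UV.2 y &
  forall M : Q, hull (\val M) `&` UV.1 = set0 \/ hull (\val M) `&` UV.2 = set0]].
have [[[U V] [Uop Vop Vy UVM] KU]|noUV] :=
    pselect (exists2 UV, D UV & K `<=` UV.1).
  apply: (filterS _ (open_nbhs_nbhs (conj Vop Vy))) => z Vz [x Kx xz].
  have [M0|M0] := UVM (quotient_map z).
    suff : set0 x by []; rewrite -M0; split; last exact: KU.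
    by rewrite -xz; exact: quotient_map_hull.
  by suff : set0 z by []; rewrite -M0; split => //; exact: quotient_map_hull.
have [||||x Kx] := @compact_directed R S _ D (fun UV => K `\` UV.1).
- exists (set0, setT); split => //=; [exact: open0|exact: openT|].
  by move=> M; left; rewrite setI0.
- move=> [U V] [/= Uop _ _ _]; rewrite setDE; apply: closedI => //.
  exact: open_closedC.
- move=> UV DUV; apply: contrapT => KUV; apply: noUV; exists UV => // x Kx.
  by apply: contrapT => Ux; apply: KUV; exists x.
- move=> [U V] [U' V'] [/= Uop Vop Vy UVM] [/= U'op V'op V'y UVM'].
  exists (U `|` U', V `&` V') => /=; last first.
    by move=> z [Kz nUU]; split; split => // Uz; apply: nUU; [left|right].
  split => //=; [exact: openU|exact: openI|move=> M].
  have [MU|MV] := UVM M; last by right; rewrite setIA MV set0I.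
  have [MU'|MV'] := UVM' M; last by right; rewrite (setIC V) setIA MV' set0I.
  by left; rewrite setIUr MU MU' setU0.
have [|Kx0 _] := Kx (set0, setT).
  split => //=; [exact: open0|exact: openT|].
  by move=> M; left; rewrite setI0.
have xy : quotient_map x <> quotient_map y by move=> xy; apply: ny; exists x.
have [U [V [Uop Vop xU yV UVM]]] := quotient_separation xy.
have [|_ nUx] := Kx (U, V); last by case: nUx; apply: xU; exact: quotient_map_hull.
by split => //; apply: yV; exact: quotient_map_hull.
Qed.

Lemma star_quotient_map (A : set S) x : star R A (quotient_map x) <->
  exists2 y, cl A y & quotient_map y = quotient_map x.
Proof.
split=> [[y [xy Ay]]|[y Ay yx]]; first by exists y => //; exact/esym/hull_quotient_map.
by exists y; split => //; exact/hull_quotient_map.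
Qed.

Lemma open_starC (A : set S) : zero_sets R A -> open (~` star R A : set Q).
Proof.
move=> ZA; exists [set ~` star R A]; last by rewrite bigcup_set1.
by move=> _ ->; exact: finI_from1.
Qed.

Lemma quotient_map_continuous : continuous quotient_map.
Proof.
move=> x B; rewrite nbhsE => -[O [Oop Ox] OB].
suff : nbhs x (quotient_map @^-1` O).
  by apply: (@filterS _ (nbhs x)) => y /OB.
move: Oop Ox => [D sD <-] [I DI Ix]; have [E sE IE] := sD _ DI.
have : nbhs x (quotient_map @^-1` I).
  rewrite -IE preimage_bigcap; apply: filter_bigI => A EA.
  have ZA : zero_sets R A by apply/set_mem/sE.
  apply: open_nbhs_nbhs; split; last by move: Ix; rewrite -IE => /(_ A EA).
  (* The preimage of [star A] is the saturation of [cl A]. *)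
  rewrite -closedC setCK; have := closed_saturation (cl_closed (A := A)).
  by congr closed; apply/seteqP; split => y /star_quotient_map.
by apply: (@filterS _ (nbhs x)) => y Iy; exists I.
Qed.

(** Zero sets [A] and [B] are chosen so that [cl A] misses the hull of [L], [cl B] misses that of
    [K], and together they cover the spectrum; every nonempty hull then meets one of them. *)
Lemma quotient_hausdorff : hausdorff_space Q.
Proof.
move=> L K LK; apply: contrapT => nLK.
have ZL := quotient_zfilter L; have ZK := quotient_zfilter K.
have LKd : hull (\val L) `<=` ~` hull (\val K).
  by move=> x Lx Kx; apply: nLK; exact: quotient_hull_inj Lx Kx.
have [B [ZB LB BK]] := zero_set_between (hull_closed ZL)
  (closed_openC (hull_closed ZK)) LKd.
have [|A [ZA BA AL]] := zero_set_between
  (open_closedC (open_interior (cl B))) (closed_openC (hull_closed ZL)).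
  by move=> x Bx Lx; apply: Bx; exact: LB.
have [||M [MA MB]] := LK (~` star R A) (~` star R B).
- apply: (@open_nbhs_nbhs Q); split; first exact: open_starC.
  by move=> [x [Lx /AL]].
- apply: (@open_nbhs_nbhs Q); split; first exact: open_starC.
  by move=> [x [Kx /BK]].
have [x Mx] := hull_nonempty (quotient_zfilter M).
have [xB|xB] := pselect ((cl B)° x).
  by apply: MB; exists x; split => //; exact: interior_subset.
by apply: MA; exists x; split => //; apply: interior_subset; exact: BA.
Qed.

(** A continuous surjection from a compact space to a Hausdorff space is closed, so closed preimages
    can be tested upstairs. *)
Lemma continuous_from_quotient (Y : topologicalType) (h : Q -> Y) :
  continuous (h \o quotient_map) -> continuous h.
Proof.
move=> /continuous_closedP hq; apply/continuous_closedP => K /hq Kcl.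
apply: compact_closed; first exact: quotient_hausdorff.
rewrite (_ : _ @^-1` _ = quotient_map @` ((h \o quotient_map) @^-1` K)).
  apply: continuous_compact.
    by apply: continuous_subspaceT; exact: quotient_map_continuous.
  exact: subclosed_compact Kcl (@SLMC_compact R S) _.
apply/seteqP; split=> [L KL|_ [x Kx <-]] //.
by have [x xL] := quotient_map_surj L; exists x => //=; rewrite xL.
Qed.

End Quotient.

(** * Descent of the semigroup structure to the quotient *)

Theorem theorem3p15 (R : realType) (S : semitopologicalSemigroupType)
    (Gamma : set (set (set S))) :
  hausdorff_space S ->
  is_quotient R Gamma ->
  (forall A B, Gamma A -> Gamma B ->
     exists2 C, Gamma C & C `<=` odot R A B) ->
  exists (gamma : SLMC R S -> quotient_space R Gamma)
    (dotplus : quotient_space R Gamma -> quotient_space R Gamma ->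
               quotient_space R Gamma),
    (* gamma x is the only element of Gamma contained in the z-filter x, and
       dotplus A B the only one contained in odot A B *)
    (forall (x : SLMC R S) (L : quotient_space R Gamma),
       \val L `<=` point_zfilter x <-> L = gamma x) /\
    (forall A B C : quotient_space R Gamma,
       \val C `<=` odot R (\val A) (\val B) <-> C = dotplus A B) /\
    let e := fun s : S => gamma (eps R s) in
    [/\ continuous e /\ (forall s t : S, e (s * t)%g = dotplus (e s) (e t)),
        right_topological_semigroup dotplus,
        dense (range e) &
        forall s : S, continuous (fun A => dotplus (e s) A)].
Proof.
move=> _ quotG odotG; pose gamma := quotient_map quotG.
have gammaP x (L : quotient_space R Gamma) :
    \val L `<=` point_zfilter x <-> L = gamma x.
  apply: (iff_trans (pure_sub_point x (@quotient_pure _ _ _ quotG L))).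
  exact: hull_quotient_map.
have gamma_cont : continuous gamma by exact: quotient_map_continuous.
have gamma_surj L : exists x, gamma x = L by exact: quotient_map_surj.
(* The z-filter of [xy] is one of those intersected in [odot], so it contains [C]. This gives both
   the uniqueness of [dotplus] and its formula. *)
have odot_gamma x y (C : quotient_space R Gamma) :
    \val C `<=` odot R (\val (gamma x)) (\val (gamma y)) ->
    C = gamma (spectrum_mul x y).
  move=> Codot; apply/gammaP => A CA; apply: (Codot _ CA).
  by apply: bigcap_zadd; try exact: quotient_zfilter; exact: quotient_map_hull.
have /choice[dotplus' dotplusP] (AB : quotient_space R Gamma * quotient_space R Gamma) :
    exists C : quotient_space R Gamma, \val C `<=` odot R (\val AB.1) (\val AB.2).
  have [C GC Codot] := odotG _ _ (set_valP AB.1) (set_valP AB.2).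
  by exists (exist _ C (mem_set GC)).
pose dotplus A B := dotplus' (A, B).
have gammaM x y : dotplus (gamma x) (gamma y) = gamma (spectrum_mul x y).
  by apply: odot_gamma; have := dotplusP (gamma x, gamma y).
exists gamma, dotplus; split => //; split.
  move=> A B C; split=> [|->]; last exact: (dotplusP (A, B)).
  have [[x <-] [y <-]] := (gamma_surj A, gamma_surj B).
  by rewrite gammaM; exact: odot_gamma.
split.
- split=> [|s t]; last by rewrite gammaM -epsM.
  by move=> s; apply: continuous_comp; [exact: eps_continuous|exact: gamma_cont].
- split=> [A B C|B].
    have [[[x <-] [y <-]] [z <-]] := (gamma_surj A, gamma_surj B, gamma_surj C).
    by rewrite !gammaM spectrum_mulA.
  have [y <-] := gamma_surj B.
  (* Composed with [gamma], the map becomes [gamma] after right multiplication by [y], which is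
     continuous on the spectrum. *)
  apply: (@continuous_from_quotient R S Gamma quotG (quotient_space R Gamma)).
  rewrite (_ : _ \o _ = gamma \o (fun x => spectrum_mul x y)).
    by move=> x; apply: continuous_comp;
      [exact: spectrum_mul_continuous|exact: gamma_cont].
  by apply/funext => z /=; exact: gammaM.
- move=> O [L OL] Oop; have [x xL] := gamma_surj L.
  have [||z [Oz [s _ sz]]] := @eps_dense R S (gamma @^-1` O).
  + by exists x; rewrite /= xL.
  + by move/continuousP : gamma_cont; apply.
  by exists (gamma z); split => //; exists s => //; rewrite sz.
- move=> s.
  apply: (@continuous_from_quotient R S Gamma quotG (quotient_space R Gamma)).
  rewrite (_ : _ \o _ = gamma \o spectrum_mul (eps R s)).
    by move=> x; apply: continuous_comp;
      [exact: eps_mul_continuous|exact: gamma_cont].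
  by apply/funext => z /=; exact: gammaM.
Qed.
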